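(* Let $n\ge1$ and $M=A7^n+w_n$ with integers $0<A<7^n$, $0<w_n<7^n$, $w_n^{6}\equiv1\pmod{7^n}$. Let $\pi\in\mathcal O_L$ be coprime to $M$ with $\left(\frac{\pi}{M}\right)_7\neq1$, and let $\tau$, $T_k$, $J_k$, $N_k$ be as in the context. Suppose further that $M$ is not divisible by any integer $x$ with $1<x<7^n$ and $x^6\equiv1\pmod{7^n}$. Then the following are equivalent: (i) $M$ is prime; (ii) there exists a primitive $7$th root of unity $\xi$ such that $\tau^{7^{n-1}}\equiv\xi\pmod M$; (iii) $T_{n-1}\equiv-1\pmod M$, $J_{n-1}\equiv-2\pmod M$ and $N_{n-1}\equiv1\pmod M$.
   Context: Let $p=7$, $\zeta=e^{2\pi\sqrt{-1}/7}$, $L=\mathbb{Q}(\zeta)$, $\mathcal O_L=\mathbb{Z}[\zeta]$, $K=\mathbb{Q}(\zeta+\zeta^{-1})$, $G=\mathrm{Gal}(L/\mathbb{Q})$, and for $c$ prime to $7$ let $\sigma_c\in G$ send $\zeta\mapsto\zeta^c$. For $\delta=\sum_{\sigma}k_\sigma\sigma\in\mathbb{Z}[G]$ and $0\neq\alpha\in L$, $\alpha^\delta=\prod_\sigma\sigma(\alpha)^{k_\sigma}$. A bar denotes $\sigma_{-1}$. Power residue symbol: for a prime ideal $\mathfrak P\nmid 7$ of $\mathcal O_L$ and $\alpha\in\mathcal O_L\setminus\mathfrak P$, $\left(\frac{\alpha}{\mathfrak P}\right)_7$ is the unique $7$th root of unity congruent to $\alpha^{(|\mathcal O_L/\mathfrak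 P|-1)/7}$ modulo $\mathfrak P$ (and $0$ if $\alpha\in\mathfrak P$); extended multiplicatively to ideals prime to $7$, and $\left(\frac{\alpha}{M}\right)_7:=\left(\frac{\alpha}{M\mathcal O_L}\right)_7$. Let $f$ be the order of $M$ mod $7$ (so $f\in\{1,2,3,6\}$). Define $\gamma\in\mathbb{Z}[G]$ by $\gamma=1-\sigma_{-1}+2(\sigma_4-\sigma_3)+3(\sigma_5-\sigma_2)$ if $f=1$; $\gamma=1+2\sigma_4+3\sigma_5$ if $f=2$; $\gamma=1-\sigma_{-1}$ if $f=3$; $\gamma=1$ if $f=6$. Then $\tau$ is respectively $\pi^{\gamma\frac{M-1}{7^n}}$, $\pi^{\gamma(\sigma_M-1)\frac{M+1}{7^n}}$, $\pi^{\gamma(\sigma_M-1)\frac{M^2+M+1}{7^n}}$, $\pi^{\gamma(\sigma_M-1)(\sigma_M+1)(\sigma_M^2+\sigma_M+1)\frac{M^2-M+1}{7^n}}$ (the exponents of $7^n$ divide the displayed integers). Let $t_k=\tau^{7^k}+\bar\tau^{7^k}\in K$ and $T_k=\sum_{i=1}^3\sigma_i(t_k)$, $J_k=\sum_{1\le i<j\le3}\sigma_i(t_k)\sigma_j(t_k)$, $N_k=\prod_{i=1}^3\sigma_i(t_k)$; these are rational numbers. Congruences modulo $M$: these elements lie in the localization of $\mathcal O_L$ at the complement of the union of the primes above $M$; $a\equiv b\pmod M$ means $a,b$ have the same image in $\mathcal O_L/M\mathcal O_L$. *)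

(* Defs.v *)
From HB Require Import structures.
From mathcomp Require Import all_boot all_order all_fingroup all_algebra.
From mathcomp Require Import all_solvable all_field.
From mathcomp Require Import ring_quotient finmap.
From mathcomp Require Import boolp classical_sets cardinality.

Set Implicit Arguments.
Unset Strict Implicit.
Unset Printing Implicit Defensive.

Import Order.TTheory GRing.Theory Num.Theory.
Local Open Scope ring_scope.

(* [7.-root (-1)] is the 7th root of -1 of least nonnegative argument, that is
   e^(i pi / 7), so [zetaC] is e^(2 i pi / 7). *)
Definition zetaC : algC := (7.-root (-1)) ^+ 2.

Lemma zetaC_prim : 7.-primitive_root zetaC.
Proof.
have r7 : (7.-root (-1 : algC)) ^+ 7 = -1 by rewrite rootCK.
have z7 : zetaC ^+ 7 = 1 by rewrite /zetaC -exprM mulnC exprM r7 sqrrN expr1n.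
have [m prim_m m7] := prim_order_exists (isT : (0 < 7)%N) z7.
have /primeP[_ /(_ m m7)] : prime 7 by [].
case/orP => /eqP mE; last by rewrite mE in prim_m.
have z1 : zetaC = 1 by have := prim_expr_order prim_m; rewrite mE expr1.
have := @rootC_lt0 algC 7 (-1) isT.
have -> : 7.-root (-1 : algC) = -1; last by rewrite oppr_lt0 ltr01.
by rewrite -[RHS]r7 exprS (exprM _ 2 3) -/zetaC z1 expr1n mulr1.
Qed.

(* [L0] is Q(zetaC) as an abstract number field embedded in algC; see [zetaE] and
   [zeta_gen] below. *)
Definition L0 : fieldExtType rat := projT1 (num_field_exists [:: zetaC]).

Definition L0_to_algC : {rmorphism L0 -> algC} :=
  projT1 (projT2 (num_field_exists [:: zetaC])).

Lemma L0_spec :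
  {z : L0 | L0_to_algC z = zetaC & <<1; z>>%VS = fullv}.
Proof.
rewrite /L0_to_algC /L0; case: (num_field_exists _) => Q [QC [[|z []] //= [zE]]].
by rewrite span_seq1 => gen; exists z.
Qed.

Definition zeta0 : L0 := s2val L0_spec.

Lemma zeta0_prim : 7.-primitive_root zeta0.
Proof.
by rewrite -(fmorph_primitive_root L0_to_algC) (s2valP L0_spec) zetaC_prim.
Qed.

Lemma L0_splitting : SplittingField.axiom L0.
Proof.
exists ('X^7 - 1); first by rewrite rpredB ?rpred1 ?rpredX //= polyOverX.
pose r := codom (fun i : 'I_7 => zeta0 ^+ i).
have Dr: 'X^7 - 1 = \prod_(y <- r) ('X - y%:P).
  by rewrite -(factor_Xn_sub_1 zeta0_prim) big_mkord big_image.
exists r; first by rewrite -Dr eqpxx.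
have gen : <<1 & [:: zeta0]>>%VS = fullv by rewrite span_seq1 (s2valP' L0_spec).
apply/eqP; rewrite eqEsubv subvf -gen adjoin_seqSr //; apply/allP=> /=.
rewrite andbT -root_prod_XsubC -Dr.
exact/unity_rootP/(prim_expr_order zeta0_prim).
Qed.

Definition L : splittingFieldType rat :=
  HB.pack_for (splittingFieldType rat) L0
    (FieldExt_isSplittingField.Build rat L0 L0_splitting).

Definition L_to_algC : {rmorphism L -> algC} := L0_to_algC.

Definition zeta : L := zeta0.

Lemma zetaE : L_to_algC zeta = zetaC.
Proof. exact: (s2valP L0_spec). Qed.

Lemma zeta_gen : <<1; zeta>>%VS = {:L}%VS.
Proof. exact: (s2valP' L0_spec). Qed.

Notation galL := (gal_of {:L}).

Lemma galL_full : 'Gal({:L} / 1)%g = [set: galL].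
Proof.
apply/setP => s; rewrite finset.in_setT gal_kAut ?sub1v //.
by rewrite kAut1E limg_gal subvv.
Qed.

Definition sigma (c : int) : galL :=
  odflt 1%g [pick s : galL | s zeta == zeta ^ c].

Definition groupring (gT : finGroupType) : Type := {ffun gT -> int}.

Section GroupRing.
Variable gT : finGroupType.
Implicit Types a b c : groupring gT.

HB.instance Definition _ := GRing.Zmodule.copy (groupring gT) {ffun gT -> int}.

Definition gr_of (g : gT) : groupring gT := [ffun h => (h == g)%:R].

Definition gr_mul a b : groupring gT :=
  [ffun g => \sum_(h : gT) a h * b (h^-1 * g)%g].

Fact gr_mulA : associative gr_mul.
Proof.
move=> a b c; apply/ffunP => g; rewrite !ffunE.
transitivity (\sum_h \sum_k a h * b (h^-1 * k)%g * c (k^-1 * g)%g).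
  apply: eq_bigr => h _; rewrite ffunE mulr_sumr.
  rewrite (reindex_inj (mulgI h^-1%g)) /=; apply: eq_bigr => k _.
  by rewrite mulrA invMg invgK -!mulgA mulKVg.
rewrite exchange_big /=; apply: eq_bigr => k _.
by rewrite ffunE mulr_suml.
Qed.

Fact gr_mul1r : left_id (gr_of 1%g) gr_mul.
Proof.
move=> a; apply/ffunP => g; rewrite !ffunE (bigD1 1%g) //= ffunE eqxx mul1r.
rewrite invg1 mul1g big1 ?addr0 // => h /negbTE h1.
by rewrite ffunE h1 mul0r.
Qed.

Fact gr_mulr1 : right_id (gr_of 1%g) gr_mul.
Proof.
move=> a; apply/ffunP => g; rewrite !ffunE (bigD1 g) //= ffunE mulVg eqxx mulr1.
rewrite big1 ?addr0 // => h /negbTE hg.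
rewrite ffunE -(inj_eq (mulgI h)) mulKVg mulg1 eq_sym hg mulr0 //.
Qed.

Fact gr_mulDl : left_distributive gr_mul +%R.
Proof.
move=> a b c; apply/ffunP => g; rewrite !ffunE -big_split /=.
by apply: eq_bigr => h _; rewrite ffunE mulrDl.
Qed.

Fact gr_mulDr : right_distributive gr_mul +%R.
Proof.
move=> a b c; apply/ffunP => g; rewrite !ffunE -big_split /=.
by apply: eq_bigr => h _; rewrite ffunE mulrDr.
Qed.

Fact gr_oner_neq0 : gr_of 1%g != 0.
Proof. by apply/eqP => /ffunP/(_ 1%g); rewrite !ffunE eqxx. Qed.

HB.instance Definition _ := GRing.Zmodule_isNzRing.Build (groupring gT)
  gr_mulA gr_mul1r gr_mulr1 gr_mulDl gr_mulDr gr_oner_neq0.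

End GroupRing.

Notation ZG := (groupring galL).

Definition sg (c : int) : ZG := gr_of (sigma c).

Definition gexp (a : L) (d : ZG) : L := \prod_(s : galL) s a ^ d s.

Definition Zzeta : {pred L} :=
  fun x => `[< exists p : {poly int}, x = (map_poly intr p).[zeta] >].

Fact Zzeta_subring : subring_closed Zzeta.
Proof.
split.
- by apply/asboolP; exists 1; rewrite rmorph1 hornerC.
- move=> _ _ /asboolP[p ->] /asboolP[q ->]; apply/asboolP.
  by exists (p - q); rewrite rmorphB hornerD hornerN.
- move=> _ _ /asboolP[p ->] /asboolP[q ->]; apply/asboolP.
  by exists (p * q); rewrite rmorphM hornerM.
Qed.

HB.instance Definition _ := GRing.isSubringClosed.Build L Zzeta Zzeta_subring.

Record OL : Type := MkOL { OL_val :> L; _ : OL_val \in Zzeta }.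

HB.instance Definition _ := [isSub for OL_val].
HB.instance Definition _ := [Choice of OL by <:].
HB.instance Definition _ := [SubChoice_isSubComNzRing of OL by <:].

Definition pideal (a : OL) : {pred OL} :=
  fun x => `[< exists y, x = a * y >].

Definition ideal_mul (I J : {pred OL}) : {pred OL} :=
  fun x => `[< exists2 s : seq (OL * OL),
    all (fun u => (u.1 \in I) && (u.2 \in J)) s
    & x = \sum_(u <- s) u.1 * u.2 >].

(* Nonzero ideals have finite quotients; [fset_set] sends infinite sets to the
   empty set, so this is 0 on the zero ideal. *)
Definition ideal_norm (I : idealr OL) : nat :=
  #|` fset_set [set: {ideal_quot I}] |.

(* In [prime_residue] the default of [xget] is not used when P does not lie
   above 7; in [power_residue] it is not used for nonzero ideals, which are
   products of prime ideals. *)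
Definition prime_residue (a : OL) (P : prime_idealr OL) : OL :=
  if a \in (P : {pred OL}) then 0
  else xget 0 [set z : OL | z ^+ 7 = 1 /\
    z - a ^+ ((ideal_norm P).-1 %/ 7) \in (P : {pred OL})]%classic.

Definition power_residue (a : OL) (I : {pred OL}) : OL :=
  xget 1 [set z : OL | exists2 Ps : seq (prime_idealr OL),
    I =i \big[ideal_mul/pideal 1]_(P <- Ps) (P : {pred OL})
    & z = \prod_(P <- Ps) prime_residue a P]%classic.

Definition coprime_to (a : OL) (M : nat) : Prop :=
  exists u v : OL, u * a + v * M%:R = 1.

Definition avoids (M : nat) (s : OL) : Prop :=
  forall P : prime_idealr OL,
    M%:R \in (P : {pred OL}) -> s \notin (P : {pred OL}).

(* [reduces M x r]: x is a fraction a / s in the localization of O_L at the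
   complement of the union of the primes above M, and its image a s^-1 in
   O_L / M O_L is the class of r. *)
Definition reduces (M : nat) (x : L) (r : OL) : Prop :=
  exists a s : OL, [/\ avoids M s, x = (a : L) / (s : L)
                     & a - r * s \in pideal M%:R].

Definition eqmodM (M : nat) (x y : L) : Prop :=
  exists r : OL, reduces M x r /\ reduces M y r.

(* The default value of [insubd] is only used when 7 divides M. *)
Definition ord7 (M : nat) : nat := #[insubd (1%g : {unit 'F_7}) M%:R]%g.

(* For M prime to 7, [ord7 M] is 1, 2, 3 or 6: the last branches of [gamma] and
   [tau_exponent] are those of order 6. *)
Definition gamma (f : nat) : ZG :=
  match f with
  | 1 => 1 - sg (-1) + 2%:R * (sg 4 - sg 3) + 3%:R * (sg 5 - sg 2)
  | 2 => 1 + 2%:R * sg 4 + 3%:R * sg 5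
  | 3 => 1 - sg (-1)
  | _ => 1
  end.

Definition tau_exponent (n M : nat) : ZG :=
  let s := sg M%:Z in
  let g := gamma (ord7 M) in
  match ord7 M with
  | 1 => g * ((M - 1) %/ 7 ^ n)%:R
  | 2 => g * (s - 1) * ((M + 1) %/ 7 ^ n)%:R
  | 3 => g * (s - 1) * ((M ^ 2 + M + 1) %/ 7 ^ n)%:R
  | _ => g * (s - 1) * (s + 1) * (s ^+ 2 + s + 1)
           * ((M ^ 2 - M + 1) %/ 7 ^ n)%:R
  end.

Definition tau (n M : nat) (pi : OL) : L := gexp pi (tau_exponent n M).

Definition t_ (n M : nat) (pi : OL) (k : nat) : L :=
  tau n M pi ^+ (7 ^ k) + sigma (-1) (tau n M pi) ^+ (7 ^ k).

Definition T_ (n M : nat) (pi : OL) (k : nat) : L :=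
  \sum_(1 <= i < 4) sigma i%:Z (t_ n M pi k).

Definition J_ (n M : nat) (pi : OL) (k : nat) : L :=
  \sum_(1 <= i < 4) \sum_(i.+1 <= j < 4)
    sigma i%:Z (t_ n M pi k) * sigma j%:Z (t_ n M pi k).

Definition N_ (n M : nat) (pi : OL) (k : nat) : L :=
  \prod_(1 <= i < 4) sigma i%:Z (t_ n M pi k).

(* Main.v *)
(** Every ring homomorphism from Z[zeta] to a field F of characteristic q <> 7 is
    determined by the primitive 7th root of unity w^b (b = 1, ..., 6) to which it
    sends zeta; call it phi_b.  An element of O_L is divisible by q iff it vanishes
    under all the phi_b, so congruences can be tested in F.

    (i) => (ii).  Let M = p be prime of order f mod 7, F = F_(p^f), e = (p^f - 1)/7.
    The prime ideals above p are the kernels of the phi_b, where phi_b and phi_c have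
    the same kernel iff c is in b<p>, and each occurs once in the factorization of
    (p).  The residue symbol of pi at the kernel of phi_b is the 7th root of unity
    rho_b in O_L such that phi_b(rho_b) = phi_b(pi)^e.  The group ring element
    gamma is the sum of k_c sigma_c over representatives c of the cosets of <p>,
    with k_c c = 1 mod 7, so phi_b(pi^gamma)^e = phi_b(R) for every b, with R the
    product of the rho_c over these representatives, that is the residue symbol
    (pi/p)_7.  As sigma_p acts as the p-th power under phi_b, the remaining factors
    of the exponent of tau raise phi_b(pi^gamma) to the power e.

    (iii) => (i).  Since bar tau = 1/tau, the conjugates of t_(n-1) having the
    elementary symmetric functions of the periods zeta^i + zeta^-i means that
    phi(tau^(7^(n-1))) is a root of 1 + X + ... + X^6 for all phi above a prime
    q | M.  Hence phi(tau) has order 7^n in F_(q^6)^*, and q^6 = 1 mod 7^n; if M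
    were not prime its least prime factor q < 7^n would be excluded by hypothesis. *)

From HB Require Import structures.
Require Import Defs.
From mathcomp Require Import all_boot all_order all_fingroup all_algebra.
From mathcomp Require Import all_solvable all_field.
From mathcomp Require Import ring_quotient finmap.
From mathcomp Require Import boolp classical_sets cardinality functions.
From mathcomp Require Import ring zify.

Set Implicit Arguments.
Unset Strict Implicit.
Unset Printing Implicit Defensive.
Import Order.TTheory GRing.Theory Num.Theory.

Local Open Scope ring_scope.

(** * Homomorphisms out of Z[zeta] *)

Definition zO : OL := insubd 0 zeta.

Lemma zO_val : zO = zeta :> L.
Proof.
rewrite /zO insubdK //; apply/asboolP; exists 'X.
by rewrite map_polyX hornerX.
Qed.

Lemma zeta_prim : 7.-primitive_root zeta.
Proof. exact: zeta0_prim. Qed.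

Lemma val_horner (p : {poly int}) (x : OL) :
  OL_val (map_poly intr p).[x] = (map_poly intr p).[x : L].
Proof.
change (val (map_poly intr p).[x] = (map_poly intr p).[val x]).
rewrite -horner_map -map_poly_comp; congr (_.[_]).
by apply: eq_map_poly => a; apply: (rmorph_int (val : {rmorphism OL -> L})).
Qed.

Lemma OL_poly (x : OL) : exists p : {poly int}, x = (map_poly intr p).[zO].
Proof.
have /asboolP[p xE] := valP x; exists p; apply: val_inj.
by rewrite /= val_horner zO_val -xE.
Qed.

Lemma sum_prim7 (R : idomainType) (w : R) :
  7.-primitive_root w -> \sum_(i < 7) w ^+ i = 0.
Proof.
move=> w_prim; have := subrX1 w 7.
rewrite (prim_expr_order w_prim) subrr => /esym/eqP; rewrite mulf_eq0.
case/orP => /eqP // /(canRL (subrK 1)); rewrite add0r => w1.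
by have := eq_prim_root_expr w_prim 1 0; rewrite w1 eqxx.
Qed.

(** The minimal polynomial of [zetaC] over Q is the 7th cyclotomic polynomial, so a nonzero rational
    polynomial vanishing there has degree at least 6. *)
Lemma zeta_small_poly (p : {poly int}) :
  (size p < 7)%N -> (map_poly intr p).[zeta] = 0 -> p = 0.
Proof.
move=> p7 /(congr1 L_to_algC); rewrite rmorph0 -horner_map zetaE -map_poly_comp.
have -> : map_poly (L_to_algC \o intr) p
    = map_poly ratr (map_poly intr p : {poly rat}).
  by rewrite -map_poly_comp; apply: eq_map_poly => a /=; rewrite !rmorph_int.
have [P [PE _] Pdvd] := minCpolyP zetaC.
move=> /eqP; rewrite -/(root _ _) Pdvd => dvdPp.
have sizeP : size P = 7%N.
  have <- : size (map_poly ratr P : {poly algC}) = size P.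
    by rewrite size_map_poly.
  by rewrite -PE (minCpoly_cyclotomic zetaC_prim) size_cyclotomic.
have sizep : size (map_poly intr p : {poly rat}) = size p.
  by rewrite size_map_inj_poly ?rmorph0 //; apply: intr_inj.
apply/eqP; rewrite -size_poly_eq0 -sizep size_poly_eq0; apply: contraTT p7 => p0.
by rewrite -leqNgt -sizep -sizeP dvdp_leq.
Qed.

(** The 7th cyclotomic polynomial. *)
Definition Psi7 : {poly int} := \poly_(i < 7) 1.

Lemma Psi7_horner (R : comNzRingType) (w : R) :
  (map_poly intr Psi7).[w] = \sum_(i < 7) w ^+ i.
Proof.
rewrite /Psi7 poly_def rmorph_sum horner_sum; apply: eq_bigr => i _ /=.
by rewrite scale1r map_polyXn hornerXn.
Qed.

Lemma Psi7_monic : Psi7 \is monic.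
Proof. by rewrite monicE /Psi7 lead_coef_poly. Qed.

(** Division by the monic [Psi7] leaves a remainder of degree less than 6 that vanishes at zeta,
    hence is zero: p is a multiple of [Psi7]. *)
Lemma zeta_poly_eq0 (R : comNzRingType) (w : R) (p : {poly int}) :
  \sum_(i < 7) w ^+ i = 0 -> (map_poly intr p).[zO] = 0 ->
  (map_poly intr p).[w] = 0.
Proof.
move=> w0 /(congr1 val); rewrite rmorph0 /= val_horner zO_val.
rewrite (Pdiv.RingMonic.rdivp_eq Psi7_monic p) !rmorphD !rmorphM !hornerD !hornerM.
rewrite !Psi7_horner w0 (sum_prim7 zeta_prim) !mulr0 !add0r.
move=> /zeta_small_poly -> //; first by rewrite rmorph0 horner0.
have := Pdiv.Ring.ltn_rmodpN0 p (monic_neq0 Psi7_monic).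
by rewrite size_poly_eq.
Qed.

(** The universal property of Z[X]/([Psi7]): f evaluates at w a chosen polynomial representing x,
    and by [zeta_poly_eq0] the choice does not matter. *)
Lemma OL_lift (R : comNzRingType) (w : R) :
  \sum_(i < 7) w ^+ i = 0 -> {f : {rmorphism OL -> R} | f zO = w}.
Proof.
move=> w0; pose f (x : OL) : R := (map_poly intr (projT1 (cid (OL_poly x)))).[w].
have fE p : f (map_poly intr p).[zO] = (map_poly intr p).[w].
  rewrite /f; case: cid => q /= /eqP; rewrite -subr_eq0 => /eqP pq.
  apply/eqP; rewrite -subr_eq0 -oppr_eq0 opprB; apply/eqP.
  rewrite -hornerN -hornerD -rmorphB; apply: (zeta_poly_eq0 w0).
  by rewrite rmorphB hornerD hornerN.
have fB : zmod_morphism f.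
  move=> x y; have [p ->] := OL_poly x; have [q ->] := OL_poly y.
  by rewrite -hornerN -hornerD -rmorphB !fE rmorphB hornerD hornerN.
have fM : monoid_morphism f.
  split=> [|x y]; first by have := fE 1; rewrite !rmorph1 !hornerC.
  have [p ->] := OL_poly x; have [q ->] := OL_poly y.
  by rewrite -hornerM -rmorphM !fE rmorphM hornerM.
pose f1 := GRing.isZmodMorphism.Build OL R f fB.
pose f2 := GRing.isMonoidMorphism.Build OL R f fM.
pose F : {rmorphism OL -> R} := HB.pack f f1 f2.
by exists F; have := fE 'X; rewrite !map_polyX !hornerX.
Qed.

Lemma OL_hom_poly (R : comNzRingType) (f : {rmorphism OL -> R}) (p : {poly int}) :
  f (map_poly intr p).[zO] = (map_poly intr p).[f zO].
Proof.
rewrite -horner_map -map_poly_comp; congr (_.[_]).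
by apply: eq_map_poly => a /=; rewrite rmorph_int.
Qed.

Lemma OL_hom_eq (R : comNzRingType) (f g : {rmorphism OL -> R}) :
  f zO = g zO -> f =1 g.
Proof. by move=> fg x; have [p ->] := OL_poly x; rewrite !OL_hom_poly fg. Qed.

Lemma zO_sum : \sum_(i < 7) zO ^+ i = 0.
Proof.
apply: val_inj; rewrite [RHS]rmorph0 rmorph_sum -[RHS](sum_prim7 zeta_prim).
by apply: eq_bigr => i _; rewrite rmorphXn /= zO_val.
Qed.

Lemma zO7 : zO ^+ 7 = 1.
Proof.
by apply: val_inj; rewrite rmorphXn rmorph1 /= zO_val (prim_expr_order zeta_prim).
Qed.

(** * Galois automorphisms on Z[zeta] *)

Lemma gal_OL (s : galL) :
  {f : {rmorphism OL -> OL} | forall x : OL, f x = s (x : L) :> L}.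
Proof.
have [i iE] : {i : 'I_7 | s zeta = zeta ^+ i}.
  apply: (prim_rootP zeta_prim).
  by rewrite -rmorphXn (prim_expr_order zeta_prim) rmorph1.
have [|f fz] := @OL_lift OL (zO ^+ i).
  apply: val_inj; rewrite [RHS]rmorph0 -(rmorph0 s) -(sum_prim7 zeta_prim).
  rewrite !rmorph_sum; apply: eq_bigr => j _.
  by rewrite !rmorphXn /= zO_val iE.
exists f => x; have [p ->] := OL_poly x.
rewrite OL_hom_poly fz !val_horner.
have -> : OL_val (zO ^+ i) = s zeta by rewrite iE -zO_val -[OL_val _]/(val _) rmorphXn.
rewrite zO_val -horner_map -map_poly_comp.
by congr (_.[_]); apply: eq_map_poly => a /=; rewrite rmorph_int.
Qed.

(** Some endomorphism u of [algC] raises 7th roots of unity to the power c, so zeta^c is a root of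
    the minimal polynomial of zeta; normality of L then yields s. *)
Lemma sigma_exists (c : nat) : ~~ (7 %| c)%N ->
  exists s : galL, s zeta = zeta ^+ c.
Proof.
move=> c7; have co : coprime c 7 by rewrite coprime_sym prime_coprime.
have [u uE] := Qn_aut_exists co.
have [|s _ sE] := @normalField_root_minPoly _ L 1%AS {:L}%AS zeta (zeta ^+ c)
  (sub1v _) (normalFieldf _) (memvf _) _; last by exists s.
have /polyOver1P[p pE] := minPolyOver 1 zeta.
have map_root x : root (minPoly 1 zeta) x = root (map_poly ratr p) (L_to_algC x).
  rewrite -(fmorph_root L_to_algC) pE -map_poly_comp; congr (root _ _).
  apply: eq_map_poly => a.
  exact: (fmorph_eq_rat (L_to_algC \o in_alg L)).
have := root_minPoly 1 zeta; rewrite !map_root -(fmorph_root u) -map_poly_comp.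
rewrite rmorphXn /= zetaE uE ?(prim_expr_order zetaC_prim) //.
by congr (root _ _); apply: eq_map_poly => a /=; rewrite fmorph_rat.
Qed.

Lemma sigmaE (c : int) (d : nat) :
  ~~ (7 %| d)%N -> zeta ^ c = zeta ^+ d -> sigma c zeta = zeta ^+ d.
Proof.
move=> d7 cd; rewrite /sigma; case: pickP => [s /eqP -> // | none].
by have [s sE] := sigma_exists d7; have := none s; rewrite sE cd eqxx.
Qed.

Lemma sigma_nat (c : nat) : ~~ (7 %| c)%N -> sigma c zeta = zeta ^+ c.
Proof. by move=> c7; apply: sigmaE. Qed.

Lemma sigma_opp1 : sigma (-1) zeta = zeta ^+ 6.
Proof.
apply: sigmaE => //; rewrite -invr_expz expr1z.
have z7 : zeta ^+ 6 * zeta = 1 by rewrite -exprSr (prim_expr_order zeta_prim).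
have z0 : zeta \is a GRing.unit.
  rewrite unitfE; apply: contra_eq_neq z7 => ->.
  by rewrite mulr0 eq_sym oner_eq0.
by apply: (mulIr z0); rewrite mulVr.
Qed.

(** * Prime ideals as preimages and kernels *)

Lemma prime_idealr_of (S : OL -> bool) :
  idealr_closed S -> prime_idealr_closed S ->
  {P : prime_idealr OL | (P : OL -> bool) = S}.
Proof.
move=> S1 S2.
pose i1 := isIdealr.Build OL S S1.
pose i2 := isPrimeIdealrClosed.Build OL S S2.
pose P : prime_idealr OL := HB.pack S i1 i2.
by exists P.
Qed.

Lemma hom_preim_prime (f : {rmorphism OL -> OL}) (P : prime_idealr OL) :
  {Q : prime_idealr OL | forall x, (x \in (Q : {pred OL})) = (f x \in (P : {pred OL}))}.
Proof.
have [||Q QE] := @prime_idealr_of (fun x => f x \in (P : {pred OL})).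
- split; rewrite ?rmorph0 ?rmorph1 -?topredE /= ?rmorph0 ?rmorph1 ?rpred0 ?idealr1 //.
  move=> a u v uP vP; rewrite unfold_in rmorphD rmorphM.
  exact: (rpredD (idealMr (f a) uP) vP).
- move=> u v uvP; have : f (u * v) \in (P : {pred OL}) by exact: uvP.
  by rewrite rmorphM prime_idealrM.
by exists Q => x; rewrite QE.
Qed.

Lemma hom_ker_prime (R : idomainType) (f : {rmorphism OL -> R}) :
  {Q : prime_idealr OL | forall x, (x \in (Q : {pred OL})) = (f x == 0)}.
Proof.
have [||Q QE] := @prime_idealr_of (fun x => f x == 0).
- split; rewrite ?unfold_in ?rmorph0 ?rmorph1 ?oner_neq0 //.
  move=> a u v; rewrite !unfold_in /= => /eqP uP /eqP vP.
  by rewrite rmorphD rmorphM uP vP mulr0 addr0.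
- by move=> u v; rewrite !unfold_in rmorphM mulf_eq0.
by exists Q => x; rewrite QE.
Qed.
(** Trades a Galois conjugate for another homomorphism, as in phi_b o sigma_c = phi_(bc). *)
Lemma gal_comp_hom (R : comNzRingType) (f h : {rmorphism OL -> R})
    (s : galL) (c : nat) :
  s zeta = zeta ^+ c -> h zO = f zO ^+ c ->
  exists2 g : {rmorphism OL -> OL}, (forall x : OL, g x = s (x : L) :> L)
    & forall x, f (g x) = h x.
Proof.
move=> sE hE; have [g gE] := gal_OL s; exists g => // x.
apply: (@OL_hom_eq _ (f \o g)); rewrite /= hE -rmorphXn; congr (f _).
by apply: val_inj; rewrite rmorphXn /= gE zO_val.
Qed.

(** * Congruences and evaluation of fractions *)

Section Ideals.
Variable M : nat.

Lemma pidealD (a x y : OL) : x \in pideal a -> y \in pideal a -> x + y \in pideal a.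
Proof.
move=> /asboolP[u ->] /asboolP[v ->]; apply/asboolP; exists (u + v).
by rewrite mulrDr.
Qed.

Lemma pidealMr (a x y : OL) : x \in pideal a -> x * y \in pideal a.
Proof. by move=> /asboolP[u ->]; apply/asboolP; exists (u * y); rewrite mulrA. Qed.

Lemma avoids1 : avoids M 1.
Proof. by move=> P _; rewrite idealr1. Qed.

Lemma avoidsM (s t : OL) : avoids M s -> avoids M t -> avoids M (s * t).
Proof.
by move=> sM tM P MP; rewrite prime_idealrM negb_or (sM P MP) (tM P MP).
Qed.

Lemma avoids_hom (f : {rmorphism OL -> OL}) (s : OL) : avoids M s -> avoids M (f s).
Proof.
move=> sM P MP; have [Q QE] := hom_preim_prime f P.
by rewrite -QE sM // QE rmorph_nat.
Qed.

Lemma coprime_avoids (s : OL) : coprime_to s M -> avoids M s.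
Proof.
move=> [u [v uv]] P MP; apply/negP => sP.
by have := idealr1 P; rewrite -uv rpredD // idealMr.
Qed.

Lemma coprime_toM (s t : OL) :
  coprime_to s M -> coprime_to t M -> coprime_to (s * t) M.
Proof.
move=> [u [v uv]] [u' [v' uv']].
exists (u * u'), (u * s * v' + v).
have -> : u * u' * (s * t) + (u * s * v' + v) * M%:R
    = u * s * (u' * t + v' * M%:R) + v * M%:R by ring.
by rewrite uv' mulr1.
Qed.

Lemma coprime_to_hom (f : {rmorphism OL -> OL}) (s : OL) :
  coprime_to s M -> coprime_to (f s) M.
Proof.
move=> [u [v uv]]; exists (f u), (f v).
by rewrite -(rmorph_nat f) -!rmorphM -rmorphD uv rmorph1.
Qed.

Lemma coprime_to1 : coprime_to 1 M.
Proof. by exists 1, 0; rewrite mul1r mul0r addr0. Qed.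

Lemma hom_avoids (R : idomainType) (f : {rmorphism OL -> R}) (s : OL) :
  f M%:R = 0 -> avoids M s -> f s != 0.
Proof.
move=> fM sM; have [Q QE] := hom_ker_prime f.
by rewrite -QE sM // QE fM.
Qed.

(** Adding fractions requires nonzero denominators; [avoids_nonzero] supplies this when M has a
    prime divisor other than 7. *)
Hypothesis avoids_neq0 : forall s, avoids M s -> s != 0.

Lemma reduces_OL (x : OL) : reduces M x x.
Proof.
exists x, 1; split; first exact: avoids1; first by rewrite divr1.
by rewrite mulr1 subrr; apply/asboolP; exists 0; rewrite mulr0.
Qed.

Lemma val_neq0 (s : OL) : s != 0 -> (s : L) != 0.
Proof. by apply: contra_neq => s0; apply: val_inj. Qed.

Lemma reducesD x y r r' :
  reduces M x r -> reduces M y r' -> reduces M (x + y) (r + r').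
Proof.
move=> [a [s [sM -> aE]]] [b [t [tM -> bE]]].
exists (a * t + b * s), (s * t); split; first exact: avoidsM.
  by rewrite /= addf_div // val_neq0 // avoids_neq0.
have -> : a * t + b * s - (r + r') * (s * t) = (a - r * s) * t + (b - r' * t) * s
  by ring.
by apply: pidealD; apply: pidealMr.
Qed.

Lemma reducesM x y r r' :
  reduces M x r -> reduces M y r' -> reduces M (x * y) (r * r').
Proof.
move=> [a [s [sM -> aE]]] [b [t [tM -> bE]]].
exists (a * b), (s * t); split; first exact: avoidsM.
  by rewrite /= mulf_div.
have -> : a * b - (r * r') * (s * t) = (a - r * s) * b + (b - r' * t) * (r * s)
  by ring.
by apply: pidealD; apply: pidealMr.
Qed.

Lemma eqmodMD x x' y y' :
  eqmodM M x x' -> eqmodM M y y' -> eqmodM M (x + y) (x' + y').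
Proof.
move=> [r [rx rx']] [t [ty ty']].
by exists (r + t); split; apply: reducesD.
Qed.

Lemma eqmodMM x x' y y' :
  eqmodM M x x' -> eqmodM M y y' -> eqmodM M (x * y) (x' * y').
Proof.
move=> [r [rx rx']] [t [ty ty']].
by exists (r * t); split; apply: reducesM.
Qed.

Lemma reduces_gal (s : galL) (f : {rmorphism OL -> OL}) x r :
  (forall x : OL, f x = s (x : L) :> L) ->
  reduces M x r -> reduces M (s x) (f r).
Proof.
move=> fE [a [t [tM -> /asboolP[y yE]]]]; exists (f a), (f t).
split; first exact: avoids_hom; first by rewrite !fE fmorph_div.
by apply/asboolP; exists (f y); rewrite -rmorphM -rmorphB yE rmorphM rmorph_nat.
Qed.

Lemma eqmodM_gal (s : galL) x y : eqmodM M x y -> eqmodM M (s x) (s y).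
Proof.
move=> [r [rx ry]]; have [f fE] := gal_OL s.
by exists (f r); split; apply: reduces_gal.
Qed.

End Ideals.

Section Evaluation.
Variables (F : fieldType).

(** The value of x under the extension of f to fractions with denominator outside its kernel; a
    relation, because f need not extend to all of L. *)
Definition ev_at (f : OL -> F) (x : L) (v : F) : Prop :=
  exists a s : OL, [/\ f s != 0, x = (a : L) / (s : L) & f a = v * f s].

Implicit Types (f : {rmorphism OL -> F}) (x y : L) (u v : F).

Lemma hom_neq0 f s : f s != 0 -> (s : L) != 0.
Proof. by move=> fs; apply: val_neq0; apply: contra_neq fs => ->; rewrite rmorph0. Qed.

Lemma ev_OL f (x : OL) : ev_at f x (f x).
Proof. by exists x, 1; rewrite rmorph1 oner_neq0 divr1 mulr1. Qed.

Lemma ev_fun f x u v : ev_at f x u -> ev_at f x v -> u = v.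
Proof.
move=> [a [s [fs -> aE]]] [b [t [ft /eqP]]].
rewrite eqr_div ?(hom_neq0 fs) ?(hom_neq0 ft) // => /eqP ab_val bE.
have ab : a * t = b * s by apply: val_inj.
apply: (mulIf (mulf_neq0 fs ft)); rewrite mulrA -aE -rmorphM ab rmorphM bE; ring.
Qed.

Lemma evD f x y u v : ev_at f x u -> ev_at f y v -> ev_at f (x + y) (u + v).
Proof.
move=> [a [s [fs -> aE]]] [b [t [ft -> bE]]].
exists (a * t + b * s), (s * t); split; first by rewrite rmorphM mulf_neq0.
  by rewrite /= addf_div // (hom_neq0 fs, hom_neq0 ft).
by rewrite rmorphD !rmorphM aE bE; ring.
Qed.

Lemma evM f x y u v : ev_at f x u -> ev_at f y v -> ev_at f (x * y) (u * v).
Proof.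
move=> [a [s [fs -> aE]]] [b [t [ft -> bE]]].
exists (a * b), (s * t); split; first by rewrite rmorphM mulf_neq0.
  by rewrite /= mulf_div.
by rewrite !rmorphM aE bE; ring.
Qed.

Lemma evV f x v : v != 0 -> ev_at f x v -> ev_at f x^-1 v^-1.
Proof.
move=> v0 [a [s [fs -> aE]]]; exists s, a; split; first by rewrite aE mulf_neq0.
  by rewrite invf_div.
by rewrite aE mulKf.
Qed.

Lemma evX f x v k : ev_at f x v -> ev_at f (x ^+ k) (v ^+ k).
Proof.
move=> xv; elim: k => [|k IH]; last by rewrite !exprS; apply: evM.
by have := ev_OL f 1; rewrite rmorph1.
Qed.

Lemma ev_gal f (h : {rmorphism OL -> F}) (s : galL) c x v :
  s zeta = zeta ^+ c -> h zO = f zO ^+ c -> ev_at h x v -> ev_at f (s x) v.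
Proof.
move=> sE hE; have [g gE gh] := gal_comp_hom sE hE.
move=> [a [t [ft -> aE]]]; exists (g a), (g t).
by rewrite !gE !gh fmorph_div.
Qed.

Lemma ev_reduces f M x r : f M%:R = 0 -> reduces M x r -> ev_at f x (f r).
Proof.
move=> fM [a [s [sM -> /asboolP[y yE]]]]; exists a, s; split=> //.
  exact: (hom_avoids fM).
by apply/eqP; rewrite -rmorphM -subr_eq0 -rmorphB yE rmorphM fM mul0r.
Qed.

(** This carries congruences modulo M into a residue field: the image of the common residue r is the
    value of both sides. *)
Lemma ev_eqmodM f M x y u v : f M%:R = 0 -> eqmodM M x y ->
  ev_at f x u -> ev_at f y v -> u = v.
Proof.
move=> fM [r [/(ev_reduces fM) rx /(ev_reduces fM) ry]].
by move=> /(ev_fun rx) <- /(ev_fun ry) <-.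
Qed.

End Evaluation.

(** * Group ring exponents *)

Section GroupRingExponent.
Implicit Types (x : L) (d e : ZG).

Lemma gexp_neq0 x d : x != 0 -> gexp x d != 0.
Proof.
move=> x0; rewrite /gexp; elim/big_rec: _ => [|s y _ y0]; first exact: oner_neq0.
by rewrite mulf_neq0 // expfz_neq0 // fmorph_eq0.
Qed.

Lemma gexpD x d e : x != 0 -> gexp x (d + e) = gexp x d * gexp x e.
Proof.
move=> x0; rewrite /gexp -big_split; apply: eq_bigr => s _ /=.
by rewrite ffunE expfzDr // fmorph_eq0.
Qed.

Lemma gexpN x d : x != 0 -> gexp x (- d) = (gexp x d)^-1.
Proof.
move=> x0; rewrite /gexp -prodfV; apply: eq_bigr => s _.
by rewrite ffunE invr_expz.
Qed.

Lemma gexp_of x (s : galL) : gexp x (gr_of s) = s x.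
Proof.
rewrite /gexp (bigD1 s) //= ffunE eqxx expr1z big1 ?mulr1 // => t /negbTE ts.
by rewrite ffunE ts expr0z.
Qed.

Lemma gexp1 x : gexp x 1 = x.
Proof. by rewrite gexp_of gal_id. Qed.

Lemma gexp_nat x k : x != 0 -> gexp x k%:R = x ^+ k.
Proof.
move=> x0; elim: k => [|k IH].
  by rewrite /gexp big1 // => s _; rewrite ffunE expr0z.
by rewrite mulrS exprS gexpD // gexp1 IH.
Qed.

Lemma gexpM x d e : x != 0 -> gexp x (d * e) = gexp (gexp x d) e.
Proof.
move=> x0; rewrite /gexp.
pose P (h k : galL) := k (h x) ^ (d h * e k).
transitivity (\prod_(h : galL) \prod_(k : galL) P h k).
  transitivity (\prod_(g : galL) \prod_(h : galL) g x ^ (d h * e (h^-1 * g)%g)).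
    apply: eq_bigr => g _; rewrite ffunE.
    apply: (big_morph (fun m : int => g x ^ m)) => // m m'.
    by rewrite expfzDr // fmorph_eq0.
  rewrite exchange_big; apply: eq_bigr => h _ /=.
  (* Substituting g = h k gives g x = k (h x) and h^-1 g = k. *)
  rewrite (reindex_inj (mulgI h)); apply: eq_bigr => k _.
  by rewrite mulKg galM ?memvf.
rewrite exchange_big; apply: eq_bigr => k _ /=.
rewrite rmorph_prod.
rewrite (big_morph (fun y => y ^ e k) (fun y z => expfzMl y z _) (exp1rz _ _)).
by apply: eq_bigr => h _; rewrite fmorphXz exprz_exp.
Qed.

End GroupRingExponent.
(** * Residue fields *)

Lemma coprime7_pow6 (m : nat) : ~~ (7 %| m)%N -> (m ^ 6 = 1 %[mod 7])%N.
Proof.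
move=> m7; rewrite -modnXm; have : (m %% 7 < 7)%N by rewrite ltn_mod.
by move: m7; rewrite /dvdn; case: (m %% 7)%N => [|[|[|[|[|[|[|]]]]]]].
Qed.

Lemma finField_prim_root (F : finFieldType) (m : nat) :
  (0 < m)%N -> (m %| #|F|.-1)%N -> exists w : F, m.-primitive_root w.
Proof.
move=> m0 mF.
have /cyclicP[g gE] := field_unit_group_cyclic [set: {unit F}]%G.
have og : #[g]%g = #|F|.-1 by rewrite orderE -gE card_finField_unit.
have [k kE] := dvdnP mF.
have k0 : (0 < k)%N.
  by rewrite lt0n; apply/eqP => k0; have := order_gt0 g; rewrite og kE k0.
exists (val (g ^+ k)%g).
have om : #[(g ^+ k)%g]%g = m by rewrite orderXdiv og kE ?dvdn_mulr // mulKn.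
have wm : (val (g ^+ k)%g) ^+ m = 1 by rewrite -FinRing.val_unitX -om expg_order.
have [m' m'_prim m'm] := prim_order_exists m0 wm.
suff -> : m = m' by [].
apply/eqP; rewrite eqn_dvd m'm andbT -om order_dvdn; apply/eqP/val_inj.
by rewrite FinRing.val_unitX (prim_expr_order m'_prim).
Qed.

Lemma residue_field (q k : nat) : prime q -> (0 < k)%N -> (7 %| q ^ k - 1)%N ->
  exists F : finFieldType, [/\ q%:R = 0 :> F, #|F| = (q ^ k)%N &
    exists w : F, 7.-primitive_root w].
Proof.
move=> q_pr k0 dvd7; have [F charF cardF] := pPrimePowerField q_pr k0.
exists F; split=> //; first by rewrite (pcharf0 charF).
by apply: finField_prim_root => //; rewrite cardF -subn1.
Qed.

Lemma prim_root7 (R : fieldType) (w : R) (b : nat) :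
  7.-primitive_root w -> ~~ (7 %| b)%N -> 7.-primitive_root (w ^+ b).
Proof.
by move=> w_prim b7; rewrite prim_root_exp_coprime // coprime_sym prime_coprime.
Qed.

(** For b divisible by 7 the homomorphism is arbitrary and only makes phi a total function on
    nat. *)
Lemma OL_hom_family (F : fieldType) (w : F) : 7.-primitive_root w ->
  {phi : nat -> {rmorphism OL -> F} |
     forall b, ~~ (7 %| b)%N -> phi b zO = w ^+ b}.
Proof.
move=> w_prim.
have exf b : {f : {rmorphism OL -> F} | ~~ (7 %| b)%N -> f zO = w ^+ b}.
  have [b7|b7] := boolP (7 %| b)%N.
    by have [f _] := OL_lift (sum_prim7 w_prim); exists f.
  by have [f fE] := OL_lift (sum_prim7 (prim_root7 w_prim b7)); exists f.
by exists (fun b => projT1 (exf b)) => b; case: (exf b).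
Qed.

(** As q^6 = 1 mod 7, the field with q^6 elements has a primitive 7th root of unity and so receives
    a homomorphism from Z[zeta]. Its kernel is a prime above M, which s avoids and 0 does not. *)
Lemma avoids_nonzero (M q : nat) : prime q -> q != 7%N -> (q %| M)%N ->
  forall s, avoids M s -> s != 0.
Proof.
move=> q_pr q7 qM s sM.
have q7' : ~~ (7 %| q)%N by rewrite dvdn_prime2 // eq_sym.
have [|F [qF _ [w w_prim]]] := @residue_field q 6 q_pr isT.
  rewrite -eqn_mod_dvd ?expn_gt0 ?prime_gt0 // eq_sym.
  by apply/eqP; rewrite coprime7_pow6.
have [f _] := OL_lift (sum_prim7 w_prim).
have fM : f M%:R = 0.
  by rewrite rmorph_nat; have [k ->] := dvdnP qM; rewrite natrM qF mulr0.
by have := hom_avoids fM sM; apply: contra_neq => ->; rewrite rmorph0.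
Qed.
(* Otherwise unification unfolds [sigma] and enumerates the Galois group. *)
Local Opaque sigma.

(** * The element tau *)

Lemma ord7_dvdn (M k : nat) : ~~ (7 %| M)%N ->
  (ord7 M %| k)%N = (M ^ k == 1 %[mod 7])%N.
Proof.
move=> M7; rewrite order_dvdn -val_eqE FinRing.val_unitX /= insubdK; last first.
  rewrite unitfE; apply: contra M7 => /eqP/(congr1 val) /=.
  by rewrite val_Fp_nat // => /eqP.
by rewrite -natrX -val_eqE /= val_Fp_nat.
Qed.

Lemma ord7_dvd6 (M : nat) : ~~ (7 %| M)%N -> (ord7 M %| 6)%N.
Proof. by move=> M7; rewrite ord7_dvdn // coprime7_pow6. Qed.

Variant ord7_spec (M : nat) : nat -> Prop :=
| Ord7_1 of (M %% 7 = 1)%N : ord7_spec M 1%N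
| Ord7_2 of (M %% 7 = 6)%N : ord7_spec M 2%N
| Ord7_3 of ((M %% 7)%N \in [:: 2; 4]%N) : ord7_spec M 3%N
| Ord7_6 of ((M %% 7)%N \in [:: 3; 5]%N) : ord7_spec M 6%N.

Lemma ord7P (M : nat) : ~~ (7 %| M)%N -> ord7_spec M (ord7 M).
Proof.
move=> M7; have d6 := ord7_dvd6 M7.
have d1 := ord7_dvdn 1 M7; have d2 := ord7_dvdn 2 M7; have d3 := ord7_dvdn 3 M7.
have : ord7 M \in divisors 6 by rewrite -dvdn_divisors.
have Mlt : (M %% 7 < 7)%N by rewrite ltn_mod.
move: d1 d2 d3; rewrite -(modnXm 1) -(modnXm 2) -(modnXm 3) => d1 d2 d3.
have -> : divisors 6 = [:: 1; 2; 3; 6]%N by [].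
rewrite !inE => /or4P[] /eqP oE; rewrite oE in d1 d2 d3 *; constructor;
  move: M7 Mlt d1 d2 d3; rewrite /dvdn; case: (M %% 7)%N => [|[|[|[|[|[|[|]]]]]]] //.
Qed.

Lemma galL_eq (s t : galL) : s zeta = t zeta -> s =1 t.
Proof.
move=> st x; have : x \in <<1; zeta>>%VS by rewrite zeta_gen memvf.
case/Fadjoin_polyP => p /polyOver1P[q ->] ->.
have E (u : galL) : u (map_poly (in_alg L) q).[zeta] = (map_poly (in_alg L) q).[u zeta].
  by rewrite -horner_map -map_poly_comp; congr (_.[_]); apply: eq_map_poly => a;
    apply: (rmorph_alg u).
by rewrite !E st.
Qed.

Lemma galL_zeta (s : galL) : exists i, s zeta = zeta ^+ i.
Proof.
have [i iE] : {i : 'I_7 | s zeta = zeta ^+ i}.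
  apply: (prim_rootP zeta_prim).
  by rewrite -rmorphXn (prim_expr_order zeta_prim) rmorph1.
by exists i.
Qed.

Lemma galL_comp (s t u : galL) (i j k : nat) :
  s zeta = zeta ^+ i -> t zeta = zeta ^+ j -> u zeta = zeta ^+ k ->
  (i * j = k %[mod 7])%N -> forall x, s (t x) = u x.
Proof.
move=> sE tE uE ijk x; rewrite -galM ?memvf //; apply: galL_eq.
rewrite galM ?memvf // tE rmorphXn /= sE uE -exprM.
by apply/eqP; rewrite (eq_prim_root_expr zeta_prim); apply/eqP.
Qed.

Lemma galL_comm (s t : galL) x : s (t x) = t (s x).
Proof.
rewrite -!galM ?memvf //; apply: galL_eq; rewrite !galM ?memvf //.
have [i iE] := galL_zeta s; have [j jE] := galL_zeta t.
by rewrite iE jE !rmorphXn /= iE jE -!exprM mulnC.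
Qed.

Lemma conjK x : sigma (-1) (sigma (-1) x) = x.
Proof.
by rewrite (galL_comp (u := 1%g) (k := 1) sigma_opp1 sigma_opp1) ?gal_id ?expr1.
Qed.

Section TauForms.
Variable x : L.
Hypothesis x0 : x != 0.
Local Notation c := (sigma (-1)).

Lemma gexp_sg y (a : int) : gexp y (sg a) = sigma a y.
Proof. exact: gexp_of. Qed.

Lemma gexpMn y (d : ZG) k : y != 0 -> gexp y (k%:R * d) = gexp y d ^+ k.
Proof.
move=> y0; rewrite mulr_natl; elim: k => [|k IH]; first exact: (gexp_nat 0).
by rewrite mulrS exprS gexpD // IH.
Qed.

Lemma gexp_gamma1 : gexp x (gamma 1) =
  x / c x * (sigma 4 x / sigma 3 x) ^+ 2 * (sigma 5 x / sigma 2 x) ^+ 3.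
Proof.
rewrite -!gexp_sg /gamma.
move: (sg _) (sg _) (sg _) (sg _) (sg _) => d1 d2 d3 d4 d5.
by rewrite !gexpD // !gexpMn // !gexpD // !gexpN // gexp1.
Qed.

Lemma gexp_gamma2 : gexp x (gamma 2) = x * sigma 4 x ^+ 2 * sigma 5 x ^+ 3.
Proof.
rewrite -!gexp_sg /gamma; move: (sg _) (sg _) => d1 d2.
by rewrite !gexpD // !gexpMn // gexp1.
Qed.

Lemma gexp_gamma3 : gexp x (gamma 3) = x / c x.
Proof.
rewrite -!gexp_sg /gamma; move: (sg _) => d1.
by rewrite !gexpD // !gexpN // gexp1.
Qed.

Lemma gexp_subr1 (a : int) : gexp x (sg a - 1) = sigma a x / x.
Proof.
by rewrite -!gexp_sg; move: (sg _) => d1; rewrite !gexpD // !gexpN // gexp1.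
Qed.

Lemma gexp_addr1 (a : int) : gexp x (sg a + 1) = sigma a x * x.
Proof.
by rewrite -!gexp_sg; move: (sg _) => d1; rewrite !gexpD // gexp1.
Qed.

Lemma gexp_sqr_addr1 (a : int) :
  gexp x (sg a ^+ 2 + sg a + 1) = sigma a (sigma a x) * sigma a x * x.
Proof.
rewrite -[sigma a (_ x)]gexp_sg -!gexp_sg; move: (sg _) => d1.
by rewrite !gexpD // expr2 gexpM // gexp1.
Qed.

End TauForms.

(** With a_i = s^i y this is the group ring identity (s - 1)(s + 1)(s^2 + s + 1) = (s + 1)(s^3 - 1),
    written multiplicatively. *)
Lemma ratio_cycle (F : fieldType) (a0 a1 a2 a3 a4 : F) :
  a0 != 0 -> a1 != 0 -> a2 != 0 -> a3 != 0 ->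
  a4 / a3 * (a3 / a2) * (a3 / a2 * (a2 / a1)) * (a2 / a1 * (a1 / a0))
  = a4 / a1 * (a3 / a0).
Proof. by move=> a00 a10 a20 a30; field; rewrite a00 a10 a20 a30. Qed.

Section Tau.
Variables (n M : nat) (pi : OL).
Hypotheses (M7 : ~~ (7 %| M)%N) (pi0 : (pi : L) != 0).
Local Notation x := (pi : L).
Local Notation c := (sigma (-1)).
Local Notation s := (sigma M%:Z).

(** The power of pi whose exponent is gamma times (X^f - 1) / Phi_f(X) at X = sigma_M, where f =
    [ord7 M] and Phi_f is the f-th cyclotomic polynomial. *)
Definition tau_base : L :=
  let y := gexp x (gamma (ord7 M)) in
  match ord7 M with
  | 1 => y
  | 2 | 3 => s y / y
  | _ => let z := s (s y / y) * (s y / y) in s (s z) * s z * z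
  end.

(** The value Phi_f(M) of the f-th cyclotomic polynomial, f = [ord7 M]. *)
Definition tau_power : nat :=
  match ord7 M with
  | 1 => M - 1
  | 2 => M + 1
  | 3 => M ^ 2 + M + 1
  | _ => M ^ 2 - M + 1
  end.

Lemma tauE : tau n M pi = tau_base ^+ (tau_power %/ 7 ^ n).
Proof.
rewrite /tau /tau_exponent /tau_base /tau_power.
have y0 := gexp_neq0 (gamma (ord7 M)) pi0; move: (gamma _) y0 => g y0.
have sy0 := gexp_neq0 (sg M - 1) y0.
have sy1 := gexp_neq0 (sg M + 1) sy0.
have sy2 := gexp_neq0 (sg M ^+ 2 + sg M + 1) sy1.
case: (ord7P M7) => _.
- by rewrite gexpM // gexp_nat.
- by rewrite !gexpM ?gexp_neq0 // gexp_nat // gexp_subr1.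
- by rewrite !gexpM ?gexp_neq0 // gexp_nat // gexp_subr1.
rewrite !gexpM ?gexp_neq0 // gexp_nat // -gexp_subr1 //.
by rewrite -(gexp_addr1 sy0) -(gexp_sqr_addr1 sy1).
Qed.

(** For such y the sum of y and its conjugate is y + 1/y, the shape of a period. *)
Definition anti (y : L) : Prop := y * c y = 1.

Lemma antiM y z : anti y -> anti z -> anti (y * z).
Proof. by move=> yE zE; rewrite /anti rmorphM mulrACA yE zE mulr1. Qed.

Lemma antiX y k : anti y -> anti (y ^+ k).
Proof. by move=> yE; rewrite /anti rmorphXn -exprMn yE expr1n. Qed.

Lemma anti_gal (t : galL) y : anti y -> anti (t y).
Proof. by move=> yE; rewrite /anti galL_comm -rmorphM yE rmorph1. Qed.

Lemma antiV y : anti y -> anti y^-1.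
Proof. by move=> yE; rewrite /anti fmorphV -invfM yE invr1. Qed.

Lemma anti_div y : y != 0 -> anti (y / c y).
Proof.
by move=> y0; rewrite /anti fmorph_div /= conjK mulrA divfK ?mulfV ?fmorph_eq0.
Qed.

Lemma zetaX_mod i j : (i = j %[mod 7])%N -> zeta ^+ i = zeta ^+ j.
Proof. by move=> ij; apply/eqP; rewrite (eq_prim_root_expr zeta_prim); apply/eqP. Qed.

Lemma sigma_M (r : nat) : (M %% 7 = r)%N -> s zeta = zeta ^+ r.
Proof. by move=> <-; rewrite sigma_nat //; apply: zetaX_mod; rewrite modn_mod. Qed.

(** For f = 1 the terms of gamma pair sigma_c with -sigma_(-c). For f = 2, sigma_M is conjugation,
    so sigma_M - 1 gives bar y / y. For f = 3, gamma is 1 - sigma_(-1). For f = 6, sigma_M^3 is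
    conjugation and [ratio_cycle] exhibits the factor sigma_M^3 - 1. *)
Lemma anti_tau : anti (tau n M pi).
Proof.
rewrite tauE /tau_base; apply: antiX; case: (ord7P M7) => Mr.
- rewrite gexp_gamma1 //.
  have c4 : sigma 3 x = c (sigma 4 x).
    rewrite (galL_comp (u := sigma 3) (k := 3) sigma_opp1 (sigma_nat (c := 4) _)) //.
    exact: sigma_nat.
  have c5 : sigma 2 x = c (sigma 5 x).
    rewrite (galL_comp (u := sigma 2) (k := 2) sigma_opp1 (sigma_nat (c := 5) _)) //.
    exact: sigma_nat.
  have A t := @anti_div (sigma t x); rewrite c4 c5.
  by apply: (antiM (antiM (anti_div _) (antiX 2 (A 4 _))) (antiX 3 (A 5 _)));
    rewrite ?fmorph_eq0.
- move: (gexp _ _) (gexp_neq0 (gamma 2) pi0) => y y0.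
  have -> : s y = c y by apply: galL_eq; rewrite (sigma_M Mr) sigma_opp1.
  by rewrite -[c y / y]invrK invf_div; apply/antiV/anti_div.
- rewrite gexp_gamma3 //; apply: antiM; last exact/antiV/anti_div.
  exact/anti_gal/anti_div.
(* Both 3 and 5 have cube -1 modulo 7. *)
have s3 y : s (s (s y)) = c y.
  have s2E : sigma 2 zeta = zeta ^+ 2 := sigma_nat (c := 2) isT.
  have s4E : sigma 4 zeta = zeta ^+ 4 := sigma_nat (c := 4) isT.
  move: Mr; rewrite !inE => /orP[] /eqP /sigma_M sE.
    by rewrite (galL_comp sE sE s2E erefl) (galL_comp s2E sE sigma_opp1 erefl).
  by rewrite (galL_comp sE sE s4E erefl) (galL_comp s4E sE sigma_opp1 erefl).
move: (gexp _ _) (gexp_neq0 (gamma 6) pi0) => y y0; cbv zeta.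
have -> : s (s (s (s y / y) * (s y / y))) * s (s (s y / y) * (s y / y)) *
    (s (s y / y) * (s y / y)) = s (c y / y) * (c y / y).
  by rewrite !(rmorphM, fmorphV) /= -!s3 ratio_cycle // !fmorph_eq0.
have A : anti (c y / y) by rewrite -[c y / y]invrK invf_div; apply/antiV/anti_div.
by apply: antiM => //; apply: anti_gal.
Qed.

End Tau.
(** * Congruences between tau and its periods *)

Section CoprimeFractions.
Variable M : nat.

(** These fractions form a Galois-stable group containing pi, hence all its group ring powers, and
    take nonzero values under every homomorphism killing M. *)
Definition coprime_frac (x : L) : Prop :=
  exists a t : OL, [/\ coprime_to a M, coprime_to t M & x = (a : L) / (t : L)].

Lemma cfrac_OL (a : OL) : coprime_to a M -> coprime_frac a.
Proof. by move=> aM; exists a, 1; split=> //; [exact: coprime_to1 | rewrite divr1]. Qed.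

Lemma cfracM x y : coprime_frac x -> coprime_frac y -> coprime_frac (x * y).
Proof.
move=> [a [t [aM tM ->]]] [b [u [bM uM ->]]]; exists (a * b), (t * u).
by split; [exact: coprime_toM | exact: coprime_toM | rewrite mulf_div].
Qed.

Lemma cfracV x : coprime_frac x -> coprime_frac x^-1.
Proof. by move=> [a [t [aM tM ->]]]; exists t, a; rewrite invf_div. Qed.

Lemma cfracX x k : coprime_frac x -> coprime_frac (x ^+ k).
Proof.
move=> xM; elim: k => [|k IH]; last by rewrite exprS; apply: cfracM.
exact: (cfrac_OL (coprime_to1 M)).
Qed.

Lemma cfrac_gal (s : galL) x : coprime_frac x -> coprime_frac (s x).
Proof.
have [g gE] := gal_OL s; move=> [a [t [aM tM ->]]]; exists (g a), (g t).
by rewrite !gE fmorph_div; split=> //; apply: coprime_to_hom.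
Qed.

Lemma cfrac_gexp x (d : ZG) : coprime_frac x -> coprime_frac (gexp x d).
Proof.
move=> xM; rewrite /gexp; elim/big_rec: _ => [|s y _ yM].
  exact: (cfrac_OL (coprime_to1 M)).
apply: cfracM => //; case: (d s) => k; last apply: cfracV;
  by apply/cfracX/cfrac_gal.
Qed.

Lemma hom_coprime (F : fieldType) (f : {rmorphism OL -> F}) a :
  f M%:R = 0 -> coprime_to a M -> f a != 0.
Proof.
move=> fM [u [v /(congr1 f)]]; rewrite rmorphD !rmorphM fM mulr0 addr0 rmorph1.
by move=> ua; apply: contra_eq_neq ua => ->; rewrite mulr0 eq_sym oner_eq0.
Qed.

Lemma cfrac_ev (F : fieldType) (f : {rmorphism OL -> F}) x :
  f M%:R = 0 -> coprime_frac x -> exists2 v, v != 0 & ev_at f x v.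
Proof.
move=> fM [a [t [aM tM ->]]].
have fa := hom_coprime fM aM; have ft := hom_coprime fM tM.
exists (f a / f t); first by rewrite mulf_neq0 ?invr_eq0.
by exists a, t; rewrite divfK.
Qed.

End CoprimeFractions.

(** * The cubic equation of the periods *)

Lemma cubic_periods (F : fieldType) (x1 x2 x3 : F) :
  let t x := x + x^-1 in x1 != 0 ->
  t x1 + t x2 + t x3 = -1 ->
  t x1 * t x2 + t x1 * t x3 + t x2 * t x3 = - 2%:R ->
  t x1 * t x2 * t x3 = 1 ->
  \sum_(i < 7) x1 ^+ i = 0.
Proof.
move=> t x10 e1 e2 e3.
(* X^3 + X^2 - 2X - 1 is the minimal polynomial of zeta + zeta^-1; x^3 times its value at x + 1/x is
   1 + x + ... + x^6. *)
have cub : t x1 ^+ 3 + t x1 ^+ 2 - 2%:R * t x1 - 1 = 0.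
  have : t x1 ^+ 3 - (t x1 + t x2 + t x3) * t x1 ^+ 2
    + (t x1 * t x2 + t x1 * t x3 + t x2 * t x3) * t x1 - t x1 * t x2 * t x3 = 0 by ring.
  by rewrite e1 e2 e3 => <-; ring.
transitivity (x1 ^+ 3 * (t x1 ^+ 3 + t x1 ^+ 2 - 2%:R * t x1 - 1)).
  by rewrite !big_ord_recr big_ord0 /= /t; field.
by rewrite cub mulr0.
Qed.

(** The power x = u^(7^(n-1)) satisfies x^7 = 1, and x = 1 would make the sum 7, which is nonzero in
    F. *)
Lemma pow7_order (F : fieldType) (u : F) (n : nat) : (0 < n)%N -> (7%:R : F) != 0 ->
  \sum_(i < 7) (u ^+ (7 ^ (n - 1))) ^+ i = 0 -> (7 ^ n).-primitive_root u.
Proof.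
move=> n0 F7 usum; set x := u ^+ _ in usum.
have x7 : x ^+ 7 = 1.
  by apply/eqP; rewrite -subr_eq0 subrX1 usum mulr0.
have x1 : x != 1.
  apply: contraNneq F7 => x1; rewrite -usum x1.
  by under eq_bigr do rewrite expr1n; rewrite sumr_const card_ord.
have u7 : u ^+ (7 ^ n) = 1.
  by rewrite -(subnK n0) expnD exprM.
have [d d_prim] := prim_order_exists (expn_gt0 7 n : (0 < 7 ^ n)%N) u7.
case/(dvdn_pfactor _ _ (isT : prime 7)) => m mn dE.
suff mE : m = n by rewrite -mE -dE.
apply/eqP; rewrite eqn_leq mn /= leqNgt; apply: contraNN x1 => mn'.
by rewrite /x -(prim_order_dvd d_prim) dE dvdn_exp2l //; lia.
Qed.

Lemma periods_elementary (F : comNzRingType) (x : F) :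
    x ^+ 7 = 1 -> \sum_(i < 7) x ^+ i = 0 ->
    let t1 := x ^+ 1 + x ^+ 6 in let t2 := x ^+ 2 + x ^+ 5 in
    let t3 := x ^+ 3 + x ^+ 4 in
  [/\ t1 + t2 + t3 = -1, t1 * t2 + t1 * t3 + t2 * t3 = -2%:R & t1 * t2 * t3 = 1].
Proof.
rewrite !big_ord_recr big_ord0 /=; set S := (_ + _) => x7 S0.
split.
- by apply/eqP; rewrite -subr_eq0 -S0 /S; apply/eqP; ring.
(* Here and below the symmetric function minus its value is a combination of S and x^7 - 1, with
   explicit cofactors. *)
- have -> : (x ^+ 1 + x ^+ 6) * (x ^+ 2 + x ^+ 5)
    + (x ^+ 1 + x ^+ 6) * (x ^+ 3 + x ^+ 4)
    + (x ^+ 2 + x ^+ 5) * (x ^+ 3 + x ^+ 4) = - 2%:R + 2%:R * S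
    + (x ^+ 7 - 1) * (2%:R * x + 2%:R * x ^+ 2 + x ^+ 3 + x ^+ 4) by rewrite /S; ring.
  by rewrite S0 x7 subrr mulr0 mul0r !addr0.
have -> : (x ^+ 1 + x ^+ 6) * (x ^+ 2 + x ^+ 5) * (x ^+ 3 + x ^+ 4)
    = 1 + S + (x ^+ 7 - 1) * (x ^+ 2 + x ^+ 4 + x ^+ 7 + 2%:R + x ^+ 3 + x ^+ 5
      + x ^+ 8 + x) by rewrite /S; ring.
by rewrite S0 x7 subrr mul0r !addr0.
Qed.

Lemma sum3E (V : nmodType) (a : nat -> V) :
  \sum_(1 <= i < 4) a i = a 1%N + a 2%N + a 3%N.
Proof. by do 3!rewrite big_ltn //; rewrite big_geq // addr0 addrA. Qed.

Lemma sum3_pairsE (R : comNzRingType) (a : nat -> R) :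
  \sum_(1 <= i < 4) \sum_(i.+1 <= j < 4) a i * a j
  = a 1%N * a 2%N + a 1%N * a 3%N + a 2%N * a 3%N.
Proof.
rewrite sum3E; do 2!rewrite big_ltn //; rewrite big_geq // big_ltn //.
by rewrite !big_geq // !addr0.
Qed.

Lemma prod3E (R : comNzRingType) (a : nat -> R) :
  \prod_(1 <= i < 4) a i = a 1%N * a 2%N * a 3%N.
Proof. by do 3!rewrite big_ltn //; rewrite big_geq // mulr1 mulrA. Qed.

Lemma T_E n M pi k : T_ n M pi k =
  sigma 1 (t_ n M pi k) + sigma 2 (t_ n M pi k) + sigma 3 (t_ n M pi k).
Proof. exact: (sum3E (fun i => sigma i%:Z (t_ n M pi k))). Qed.

Lemma J_E n M pi k : J_ n M pi k =
  sigma 1 (t_ n M pi k) * sigma 2 (t_ n M pi k)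
  + sigma 1 (t_ n M pi k) * sigma 3 (t_ n M pi k)
  + sigma 2 (t_ n M pi k) * sigma 3 (t_ n M pi k).
Proof. exact: (sum3_pairsE (fun i => sigma i%:Z (t_ n M pi k))). Qed.

Lemma N_E n M pi k : N_ n M pi k =
  sigma 1 (t_ n M pi k) * sigma 2 (t_ n M pi k) * sigma 3 (t_ n M pi k).
Proof. exact: (prod3E (fun i => sigma i%:Z (t_ n M pi k))). Qed.

(** * The implication (ii) => (iii), and the order of a prime divisor of M under (iii) *)

Section Main.
Variables (n M : nat) (pi : OL).
Hypotheses (n_gt0 : (0 < n)%N) (M7 : ~~ (7 %| M)%N) (piM : coprime_to pi M).

Section PrimeDivisor.
Variable q : nat.
Hypotheses (q_pr : prime q) (qM : (q %| M)%N).

Lemma q_neq7 : q != 7%N.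
Proof. by apply: contraNneq M7 => <-. Qed.

Lemma q_ndiv7 : ~~ (7 %| q)%N.
Proof. by rewrite dvdn_prime2 // eq_sym q_neq7. Qed.

Lemma M_avoids_neq0 s : avoids M s -> s != 0.
Proof. exact: (avoids_nonzero q_pr q_neq7 qM). Qed.

Lemma pi_neq0 : (pi : L) != 0.
Proof. exact/val_neq0/M_avoids_neq0/coprime_avoids. Qed.

Lemma natr7_neq0 (F : fieldType) : q%:R = 0 :> F -> (7%:R : F) != 0.
Proof.
move=> qF; have q_pchar : q \in [pchar F] by rewrite inE q_pr qF eqxx.
by rewrite -(dvdn_pcharf q_pchar) dvdn_prime2 // q_neq7.
Qed.

Lemma periods_imply_congr :
  eqmodM M (T_ n M pi (n - 1)) (-1) -> eqmodM M (J_ n M pi (n - 1)) (-2) ->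
  eqmodM M (N_ n M pi (n - 1)) 1 -> (q ^ 6 = 1 %[mod 7 ^ n])%N.
Proof.
move=> TE JE NE.
have [|F [qF cardF [w w_prim]]] := @residue_field q 6 q_pr isT.
  by rewrite -eqn_mod_dvd ?expn_gt0 ?prime_gt0 // eq_sym; apply/eqP;
    rewrite coprime7_pow6 // q_ndiv7.
have [f _] := OL_lift (sum_prim7 w_prim).
have fM : f M%:R = 0.
  by rewrite rmorph_nat; have [k ->] := dvdnP qM; rewrite natrM qF mulr0.
have cf : coprime_frac M (tau n M pi) by apply/cfrac_gexp/cfrac_OL.
set x := tau n M pi in cf *.
have ev_t i : exists2 v, v != 0 & ev_at f (sigma i x) v.
  exact/(cfrac_ev fM)/cfrac_gal.
have tE i v : v != 0 -> ev_at f (sigma i x) v ->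
    ev_at f (sigma i (t_ n M pi (n - 1)))
      (v ^+ (7 ^ (n - 1)) + (v ^+ (7 ^ (n - 1)))^-1).
  move=> v0 xv; rewrite /t_ -/x rmorphD !rmorphXn /=.
  (* By [anti_tau], so the conjugates of t_(n-1) take values of the form v + 1/v needed in
     [cubic_periods]. *)
  have -> : sigma (-1) x = x^-1.
    have x1 : x * sigma (-1) x = 1 := anti_tau n M7 pi_neq0.
    have x0 : x != 0.
      by apply: contra_eq_neq x1 => ->; rewrite mul0r eq_sym oner_eq0.
    by apply: (mulfI x0); rewrite x1 mulfV.
  rewrite fmorphV -exprVn; apply: evD; apply: evX => //.
  exact: evV.
have [v1 v10 xv1] := ev_t 1; have [v2 v20 xv2] := ev_t 2; have [v3 v30 xv3] := ev_t 3.
have t1 := tE _ _ v10 xv1; have t2 := tE _ _ v20 xv2; have t3 := tE _ _ v30 xv3.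
have evc (a : OL) : ev_at f a (f a) by apply: ev_OL.
have e1 := ev_eqmodM fM TE _ (evc (-1)); rewrite rmorphN1 in e1.
have e2 := ev_eqmodM fM JE _ (evc (-2%:R)); rewrite rmorphN rmorph_nat in e2.
have e3 := ev_eqmodM fM NE _ (evc 1); rewrite rmorph1 in e3.
have vprim : (7 ^ n).-primitive_root v1.
  apply: pow7_order => //; first exact: natr7_neq0.
  apply: (@cubic_periods _ _ (v2 ^+ (7 ^ (n - 1))) (v3 ^+ (7 ^ (n - 1)))) => /=.
  - by rewrite expf_neq0.
  - apply: e1; rewrite T_E.
    by apply: evD => //; apply: evD.
  - apply: e2; rewrite J_E.
    by apply: evD; [apply: evD|]; apply: evM.
  apply: e3; rewrite N_E.
  by apply: evM => //; apply: evM.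
(* F has q^6 elements, so the order 7^n of [v1] divides q^6 - 1. *)
have : v1 ^+ (q ^ 6 - 1) = 1.
  apply: (mulfI v10); rewrite -exprS mulr1 subn1 prednK ?expn_gt0 ?prime_gt0 //.
  by rewrite -cardF expf_card.
move/eqP; rewrite -(prim_order_dvd vprim) -eqn_mod_dvd ?expn_gt0 ?prime_gt0 //.
by move/eqP.
Qed.

Lemma tau_congr_imply_periods xi : 7.-primitive_root xi ->
  eqmodM M (tau n M pi ^+ (7 ^ (n - 1))) xi ->
  [/\ eqmodM M (T_ n M pi (n - 1)) (-1), eqmodM M (J_ n M pi (n - 1)) (-2)
    & eqmodM M (N_ n M pi (n - 1)) 1].
Proof.
move=> xi_prim xiE.
have mD := eqmodMD M_avoids_neq0; have mM := @eqmodMM M.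
have xi7 := prim_expr_order xi_prim; have xi_sum := sum_prim7 xi_prim.
have [k xiz] : {k : 'I_7 | xi = zeta ^+ k}.
  exact: (prim_rootP zeta_prim).
have gE (s : galL) i : s zeta = zeta ^+ i -> s xi = xi ^+ i.
  by move=> sE; rewrite xiz rmorphXn /= sE -!exprM mulnC.
(* Conjugation is zeta -> zeta^6, whence the exponent 6i; for i = 2, 3 it is 5, 4 modulo 7, as in
   [periods_elementary]. *)
have tE i : ~~ (7 %| i)%N ->
    eqmodM M (sigma i%:Z (t_ n M pi (n - 1))) (xi ^+ i + xi ^+ (6 * i)).
  move=> i7; have -> : xi ^+ i + xi ^+ (6 * i) = sigma i%:Z (xi + sigma (-1) xi).
    rewrite (gE _ _ sigma_opp1) rmorphD rmorphXn /= (gE _ _ (sigma_nat i7)).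
    by rewrite -exprM mulnC.
  apply: eqmodM_gal; rewrite /t_; apply: mD => //.
  by rewrite -rmorphXn; apply: eqmodM_gal.
have t1 := tE 1%N isT; have t2 := tE 2%N isT; have t3 := tE 3%N isT.
have x12 : xi ^+ (6 * 2) = xi ^+ 5 by rewrite (exprD _ 7 5) xi7 mul1r.
have x18 : xi ^+ (6 * 3) = xi ^+ 4.
  by rewrite (exprD _ 14 4) (exprM _ 7 2) xi7 expr1n mul1r.
rewrite x12 in t2; rewrite x18 in t3.
have [<- e2 e3] := periods_elementary xi7 xi_sum.
rewrite -e2 -[1]e3 T_E J_E N_E.
split; first by apply: (mD) => //; apply: mD.
  by apply: (mD); [apply: (mD)|]; apply: mM.
by apply: (mM) => //; apply: mM.
Qed.

End PrimeDivisor.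
End Main.
(** * Prime ideals above p *)

Lemma root7_zO (r : OL) : r ^+ 7 = 1 -> exists k : nat, r = zO ^+ k.
Proof.
move=> /(congr1 val); rewrite rmorphXn rmorph1 => /(prim_rootP zeta_prim)[k kE].
by exists k; apply: val_inj; rewrite kE rmorphXn /= zO_val.
Qed.

Section PrimeModulus.
Variables (p f : nat) (F : finFieldType) (w : F).
Variable phi : nat -> {rmorphism OL -> F}.
Hypotheses (p_pr : prime p) (p7 : ~~ (7 %| p)%N) (fE : f = ord7 p).
Hypotheses (pF : p%:R = 0 :> F) (cardF : #|F| = (p ^ f)%N).
Hypotheses (w_prim : 7.-primitive_root w).
Hypothesis phiE : forall b, ~~ (7 %| b)%N -> phi b zO = w ^+ b.

Lemma p_pchar : p \in [pchar F].
Proof. by rewrite inE p_pr pF eqxx. Qed.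

Lemma natF_eq0 k : (k%:R == 0 :> F) = (p %| k)%N.
Proof. by rewrite -(dvdn_pcharf p_pchar). Qed.

Lemma intF_eq0 (a : int) : (a%:~R == 0 :> F) = (p%:Z %| a)%Z.
Proof.
rewrite dvdzE /= -natF_eq0; case: a => k //=.
by rewrite NegzE rmorphN oppr_eq0.
Qed.

Lemma wX_eq b c : (w ^+ b == w ^+ c) = (b == c %[mod 7]).
Proof. exact: eq_prim_root_expr. Qed.

Lemma ndvd7M b c : ~~ (7 %| b)%N -> ~~ (7 %| c)%N -> ~~ (7 %| b * c)%N.
Proof. by move=> b7 c7; rewrite Euclid_dvdM // negb_or b7. Qed.

Lemma ndvd7X j : ~~ (7 %| p ^ j)%N.
Proof. by rewrite Euclid_dvdX // negb_and p7. Qed.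

Lemma ndvd7_mod b c : (b = c %[mod 7])%N -> (7 %| b)%N = (7 %| c)%N.
Proof. by rewrite /dvdn => ->. Qed.

Lemma phi_mod b c : ~~ (7 %| b)%N -> (b = c %[mod 7])%N -> phi b =1 phi c.
Proof.
move=> b7 bc; apply: OL_hom_eq; rewrite !phiE // -?(ndvd7_mod bc) //.
by apply/eqP; rewrite wX_eq bc.
Qed.

(** Frobenius after phi_b is a homomorphism, so a comparison at [zO] suffices. *)
Lemma phi_frob b x : ~~ (7 %| b)%N -> phi (b * p) x = phi b x ^+ p.
Proof.
move=> b7; rewrite -(pFrobenius_autE p_pchar).
apply: (@OL_hom_eq _ (phi (b * p)) (pFrobenius_aut p_pchar \o phi b)).
by rewrite /= pFrobenius_autE !phiE ?ndvd7M // exprM.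
Qed.

Lemma phi_frobX b j x : ~~ (7 %| b)%N -> phi (b * p ^ j) x = phi b x ^+ (p ^ j).
Proof.
move=> b7; elim: j => [|j IH]; first by rewrite muln1 expr1.
by rewrite expnSr mulnA phi_frob ?IH ?ndvd7M ?ndvd7X // exprM.
Qed.

Lemma phi_p b : phi b p%:R = 0.
Proof. by rewrite rmorph_nat. Qed.

Lemma phi_mul_root b (r : OL) c : r ^+ 7 = 1 -> ~~ (7 %| b)%N -> ~~ (7 %| c)%N ->
  phi (b * c) r = phi b r ^+ c.
Proof.
move=> r7 b7 c7; have [k ->] := root7_zO r7.
by rewrite !rmorphXn /= !phiE ?ndvd7M // -!exprM; congr (_ ^+ _); lia.
Qed.

Lemma OL_small_poly (x : OL) :
  exists2 h : {poly int}, (size h < 7)%N & x = (map_poly intr h).[zO].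
Proof.
have [h ->] := OL_poly x; exists (Pdiv.Ring.rmodp h Psi7).
  have := Pdiv.Ring.ltn_rmodpN0 h (monic_neq0 Psi7_monic).
  by rewrite size_poly_eq.
rewrite {1}(Pdiv.RingMonic.rdivp_eq Psi7_monic h) rmorphD rmorphM hornerD hornerM.
by rewrite Psi7_horner zO_sum mulr0 add0r.
Qed.

(** A representing polynomial of degree at most 5 has the six distinct roots w, ..., w^6 in F, so p
    divides all its coefficients. *)
Lemma phi_all_eq0 x : (forall b, ~~ (7 %| b)%N -> phi b x = 0) ->
  exists y, x = p%:R * y.
Proof.
have [h h7 ->] := OL_small_poly x => x0.
have hF0 : map_poly intr h = 0 :> {poly F}.
  apply/eqP; apply: contraTT h7 => hF0; rewrite -leqNgt.
  pose rs := [seq w ^+ b | b <- iota 1 6].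
  have rs_roots : all (root (map_poly intr h)) rs.
    apply/allP => _ /mapP[b b6 ->].
    have b7 : ~~ (7 %| b)%N by move: b b6; apply/allP.
    by rewrite /root -phiE // -OL_hom_poly x0.
  have rs_uniq : uniq rs.
    rewrite map_inj_in_uniq ?iota_uniq // => b c b6 c6 /eqP; rewrite wX_eq.
    have m b' : b' \in iota 1 6 -> (b' %% 7 = b')%N.
      by rewrite mem_iota => /andP[_]; apply: modn_small.
    by rewrite !m // => /eqP.
  apply: leq_trans (max_poly_roots hF0 rs_roots rs_uniq) _.
  exact: size_poly.
have hd i : (p%:Z %| h`_i)%Z.
  by rewrite -intF_eq0 -coef_map hF0 coef0.
pose g := \poly_(i < size h) (h`_i %/ p%:Z)%Z.
exists (map_poly intr g).[zO].
have -> : h = p%:Z *: g.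
  apply/polyP => i; rewrite coefZ coef_poly.
  case: ltnP => hi; first by rewrite mulrC divzK.
  by rewrite nth_default ?mulr0.
by rewrite map_polyZ hornerZ.
Qed.

Lemma p_gt0 : (0 < p)%N.
Proof. exact: prime_gt0. Qed.

Lemma natF_inj k l : (k < p)%N -> (l < p)%N -> k%:R = l%:R :> F -> k = l.
Proof.
wlog kl : k l / (k <= l)%N.
  by move=> W kp lp; have [/W|/ltnW /W W' /esym/W' ->] := leqP k l; [exact|..].
move=> kp lp /eqP; rewrite eq_sym -subr_eq0 -natrB // natF_eq0 => /dvdn_leq.
by case: (posnP (l - k)) => [|lt0 /(_ isT)]; lia.
Qed.

Lemma frob_orbit_uniq b : ~~ (7 %| b)%N ->
  uniq [seq w ^+ (b * p ^ j) | j <- iota 0 f].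
Proof.
move=> b7; rewrite map_inj_in_uniq ?iota_uniq //.
have lt_inj i j : (i <= j < f)%N -> w ^+ (b * p ^ i) = w ^+ (b * p ^ j) -> i = j.
  move=> /andP[ij jf] /eqP; rewrite wX_eq -{1}(subnKC ij) expnD mulnA.
  rewrite eq_sym eqn_mod_dvd ?leq_pmulr ?expn_gt0 ?p_gt0 //.
  rewrite -[X in (_ - X)%N]muln1 -mulnBr Gauss_dvdr; last first.
    by rewrite prime_coprime // ndvd7M // ndvd7X.
  rewrite -eqn_mod_dvd ?expn_gt0 ?p_gt0 // -ord7_dvdn // -fE => /dvdn_leq.
  case: (posnP (j - i)).
    by lia.
  by move=> ji /(_ isT); lia.
move=> i j; rewrite !mem_iota !add0n => /andP[_ jf] /andP[_ if_] ij.
by have [le|/ltnW le] := leqP i j; [|apply/esym]; apply: lt_inj => //; rewrite le.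
Qed.

(** Two such polynomials agreeing at w^b agree, by Frobenius, at the f points w^(b p^j); their
    difference has degree less than f. *)
Lemma short_poly_inj b (a a' : 'I_p ^ f) : ~~ (7 %| b)%N ->
  \sum_(i < f) (a i)%:R * (w ^+ b) ^+ i = \sum_(i < f) (a' i)%:R * (w ^+ b) ^+ i ->
  a = a'.
Proof.
move=> b7 aa'.
pose h (c : 'I_p ^ f) : {poly F} :=
  \poly_(i < f) (if insub i is Some j then (c j)%:R else 0).
have hE c y : (h c).[y] = \sum_(i < f) (c i)%:R * y ^+ i.
  by rewrite horner_poly; apply: eq_bigr => i _; rewrite valK.
pose X (c : 'I_p ^ f) : OL := \sum_(i < f) (c i)%:R * zO ^+ i.
have phiX c d : ~~ (7 %| d)%N -> phi d (X c) = (h c).[w ^+ d].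
  move=> d7; rewrite hE rmorph_sum; apply: eq_bigr => i _.
  by rewrite rmorphM rmorph_nat rmorphXn /= phiE.
have XX j : phi (b * p ^ j) (X a) = phi (b * p ^ j) (X a').
  by rewrite !phi_frobX // !phiX // !hE aa'.
have h0 : h a - h a' = 0.
  pose rs := [seq w ^+ (b * p ^ j) | j <- iota 0 f].
  apply/eqP; apply: contraT => hn0.
  have : (size rs < size (h a - h a')%R)%N.
    apply: max_poly_roots hn0 _ (frob_orbit_uniq b7).
    apply/allP => _ /mapP[j _ ->]; rewrite /root hornerD hornerN.
    by rewrite -!phiX ?ndvd7M ?ndvd7X // XX subrr.
  rewrite size_map size_iota ltnNge => /negP[].
  apply: leq_trans (size_polyD _ _) _.
  by rewrite size_polyN geq_max !size_poly.
apply/ffunP => i; apply: val_inj.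
have /eqP : (h a - h a')`_i = 0 by rewrite h0 coef0.
rewrite coefB !coef_poly ltn_ord valK subr_eq0.
by move/eqP; apply: natF_inj.
Qed.

(** Injectivity suffices, as there are p^f coefficient vectors and p^f elements of F. *)
Lemma short_poly_surj b y : ~~ (7 %| b)%N ->
  exists a : 'I_p ^ f, y = \sum_(i < f) (a i)%:R * (w ^+ b) ^+ i.
Proof.
move=> b7.
pose g (a : 'I_p ^ f) := \sum_(i < f) (a i)%:R * (w ^+ b) ^+ i.
have g_inj : injective g by move=> a a'; apply: short_poly_inj.
have /codomP[a aE] : y \in codom g.
  by apply: inj_card_onto => //; rewrite cardF card_ffun !card_ord.
by exists a.
Qed.

Lemma phi_surj b y : ~~ (7 %| b)%N -> exists x, phi b x = y.
Proof.
move=> b7; have [a ->] := short_poly_surj y b7.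
exists (\sum_(i < f) (a i)%:R * zO ^+ i).
rewrite rmorph_sum; apply: eq_bigr => i _.
by rewrite rmorphM rmorph_nat rmorphXn /= phiE.
Qed.

(* By surjectivity, w^(bf) is a combination of the lower powers of w^b, so the
   orbit of w^b under Frobenius is the root set of a monic integral polynomial. *)
Lemma ker_phi_sub b c : ~~ (7 %| b)%N -> ~~ (7 %| c)%N ->
  (forall x, phi b x = 0 -> phi c x = 0) ->
  exists2 j, (j < f)%N & (c = b * p ^ j %[mod 7])%N.
Proof.
move=> b7 c7 bc; have [a aE] := short_poly_surj ((w ^+ b) ^+ f) b7.
pose h : {poly int} := \poly_(i < f) (if insub i is Some j then (a j)%:R else 0).
pose g := 'X^f - h.
have hE d : ~~ (7 %| d)%N ->
    phi d (map_poly intr g).[zO] = (map_poly intr g).[w ^+ d].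
  by move=> d7; rewrite OL_hom_poly phiE.
have size_g : size (map_poly intr g : {poly F}) = f.+1.
  rewrite /g rmorphB /= map_polyXn size_polyDl size_polyXn // size_polyN.
  by rewrite ltnS (leq_trans (size_poly _ _)) // size_poly.
have g0 : (map_poly intr g).[w ^+ b] = 0.
  rewrite /g rmorphB /= map_polyXn hornerD hornerN hornerXn aE.
  rewrite (horner_coef_wide _ (n := f)); last first.
    by rewrite (leq_trans (size_poly _ _)) // size_poly.
  apply/eqP; rewrite subr_eq0; apply/eqP/eq_bigr => i _.
  by rewrite coef_map coef_poly ltn_ord valK /= mulrz_nat.
have g0c : (map_poly intr g).[w ^+ c] = 0 by rewrite -hE // bc // hE.
have [|no] := boolP (w ^+ c \in [seq w ^+ (b * p ^ j) | j <- iota 0 f]).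
  case/mapP => j; rewrite mem_iota add0n => /andP[_ jf] /eqP; rewrite wX_eq => /eqP.
  by exists j.
have : (size (w ^+ c :: [seq w ^+ (b * p ^ j) | j <- iota 0 f]) < f.+1)%N.
  rewrite -[X in (_ < X)%N]size_g; apply: max_poly_roots.
  - by rewrite -size_poly_eq0 size_g.
  - rewrite /= /root g0c eqxx; apply/allP => _ /mapP[j _ ->].
    rewrite /root -hE ?ndvd7M ?ndvd7X // phi_frobX // hE // g0.
    by rewrite expr0n expn_eq0 eqn0Ngt p_gt0.
  - by rewrite cons_uniq no frob_orbit_uniq.
by rewrite /= size_map size_iota ltnn.
Qed.

Lemma phi_frob_eq0 b j x : ~~ (7 %| b)%N -> (phi (b * p ^ j) x == 0) = (phi b x == 0).
Proof. by move=> b7; rewrite phi_frobX // expf_eq0 expn_gt0 p_gt0. Qed.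

Definition is_ker (b : nat) (P : prime_idealr OL) : bool :=
  `[< forall x, (x \in (P : {pred OL})) = (phi b x == 0) >].

Lemma is_kerP b (P : prime_idealr OL) :
  reflect (forall x, (x \in (P : {pred OL})) = (phi b x == 0)) (is_ker b P).
Proof. exact: asboolP. Qed.

(** If P contained no ker phi_b, elements of these kernels outside P would have a product killed by
    all phi_b, hence in (p) and so in the prime ideal P. *)
Lemma prime_above_p (P : prime_idealr OL) : p%:R \in (P : {pred OL}) ->
  exists2 b, b \in iota 1 6 & is_ker b P.
Proof.
move=> pP; have b7P b : b \in iota 1 6 -> ~~ (7 %| b)%N by move: b; apply/allP.
have [b b6 bP] : exists2 b, b \in iota 1 6 &
    forall x, phi b x = 0 -> x \in (P : {pred OL}).
  apply: contrapT => none.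
  have ex b : exists x, b \in iota 1 6 -> phi b x = 0 /\ x \notin (P : {pred OL}).
    apply: contrapT => nx; apply: none.
    have b6 : b \in iota 1 6.
      by apply: contrapT => b6; apply: nx; exists 0 => b6'.
    exists b => // x bx; apply: contrapT => /negP xP; apply: nx.
    by exists x.
  have [xs xsE] := choice ex.
  have [|y yE] := @phi_all_eq0 (\prod_(b <- iota 1 6) xs b).
    move=> b b7; have b6 : (b %% 7)%N \in iota 1 6.
      by rewrite mem_iota ltn_mod lt0n b7.
    rewrite (phi_mod b7 (esym (modn_mod _ _))) rmorph_prod.
    by rewrite (bigD1_seq _ b6) ?iota_uniq //= (xsE _ b6).1 mul0r.
  have : \prod_(b <- iota 1 6) xs b \notin (P : {pred OL}).
    rewrite big_seq; elim/big_rec: _ => [|b x b6 xP]; first by rewrite idealr1.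
    by rewrite prime_idealrM negb_or xP (xsE _ b6).2.
  by rewrite yE mulrC idealMr.
exists b => //; apply/is_kerP => x; apply/idP/eqP => [xP|/bP //].
(* The kernel is maximal: some y inverts x modulo ker phi_b, so an x in P outside the kernel would
   put 1 in P. *)
apply/eqP; apply: contraT => bx0.
have [y yE] := phi_surj (phi b x)^-1 (b7P _ b6).
have : y * x - 1 \in (P : {pred OL}).
  by apply: bP; rewrite rmorphB rmorphM yE mulVf // rmorph1 subrr.
move=> H; have := rpredB (idealMr y xP) H; rewrite opprB addrC subrK.
by rewrite idealr1.
Qed.

Lemma ideal_norm_ker b (P : prime_idealr OL) :
  ~~ (7 %| b)%N -> is_ker b P -> ideal_norm P = (p ^ f)%N.
Proof.
move=> b7 /is_kerP bP; rewrite -cardF; apply: card_fset_set; apply/card_set_bijP.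
have eq_quot (x y : OL) : (x == y %[mod {ideal_quot P}])%qT = (phi b x == phi b y).
  by rewrite -Quotient.idealrBE bP rmorphB subr_eq0.
(* The map phi_b identifies the quotient with F, and [enum_rank] numbers F by the integers below its
   cardinal. *)
exists (fun u : {ideal_quot P} =>
  enum_rank (phi b (generic_quotient.repr u)) : nat); split.
- by move=> u _ /=; rewrite ltn_ord.
- move=> u v _ _ /val_inj/enum_rank_inj/eqP; rewrite -eq_quot !reprK.
  by move/eqP.
- move=> k /= kF; have [x xE] := phi_surj (enum_val (Ordinal kF)) b7.
  exists (\pi_({ideal_quot P})%qT x) => //=.
  have /eqP -> : phi b (generic_quotient.repr (\pi_({ideal_quot P})%qT x)) == phi b x.
    by rewrite -eq_quot reprK.
  by rewrite xE enum_valK.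
Qed.

Local Notation e := ((p ^ f).-1 %/ 7)%N.

(** * Residue symbols *)

Lemma dvd7_pf : (7 %| (p ^ f).-1)%N.
Proof.
by rewrite -subn1 -eqn_mod_dvd ?expn_gt0 ?p_gt0 // -ord7_dvdn // fE.
Qed.

Lemma b7_iota b : b \in iota 1 6 -> ~~ (7 %| b)%N.
Proof. by move: b; apply/allP. Qed.

Lemma root7_inj b (r r' : OL) : ~~ (7 %| b)%N -> r ^+ 7 = 1 -> r' ^+ 7 = 1 ->
  phi b r = phi b r' -> r = r'.
Proof.
move=> b7 /root7_zO[i ->] /root7_zO[j ->]; rewrite !rmorphXn /= phiE //.
move/eqP; rewrite (eq_prim_root_expr (prim_root7 w_prim b7)) => /eqP ij.
by rewrite -(expr_mod i zO7) ij (expr_mod j zO7).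
Qed.

Section Residues.
Variable pi : OL.
Hypothesis pi_p : coprime_to pi p.

Lemma phi_pi_neq0 b : phi b pi != 0.
Proof. exact: (hom_coprime (phi_p b)). Qed.

(** The condition on b stands under the existential so that [choice] gives a function on all of
    nat. *)
Lemma residue_exists b : exists r, ~~ (7 %| b)%N ->
  r ^+ 7 = 1 /\ phi b r = phi b pi ^+ e.
Proof.
have [b7|b7] := boolP (7 %| b)%N; first by exists 0.
have u7 : (phi b pi ^+ e) ^+ 7 = 1.
  rewrite -exprM divnK ?dvd7_pf //.
  apply: (mulfI (phi_pi_neq0 b)); rewrite -exprS mulr1 prednK ?expn_gt0 ?p_gt0 //.
  by rewrite -cardF expf_card.
have [k kE] := prim_rootP (prim_root7 w_prim b7) u7.
exists (zO ^+ k) => _; split; first by rewrite exprAC zO7 expr1n.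
by rewrite rmorphXn /= phiE // kE.
Qed.

Definition rho : nat -> OL := projT1 (choice residue_exists).

Lemma rho7 b : ~~ (7 %| b)%N -> rho b ^+ 7 = 1.
Proof. by move=> b7; have [] := projT2 (choice residue_exists) b b7. Qed.

Lemma phi_rho b : ~~ (7 %| b)%N -> phi b (rho b) = phi b pi ^+ e.
Proof. by move=> b7; have [] := projT2 (choice residue_exists) b b7. Qed.

Lemma rho_mod b c : ~~ (7 %| b)%N -> (b = c %[mod 7])%N -> rho b = rho c.
Proof.
move=> b7 bc; have c7 : ~~ (7 %| c)%N by rewrite -(ndvd7_mod bc).
apply: (root7_inj b7); rewrite ?rho7 //.
by rewrite phi_rho // !(phi_mod b7 bc) phi_rho.
Qed.

(** The symbol depends only on the kernel: applying Frobenius to the equation defining rho_b gives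
    the one defining rho_(bp). *)
Lemma rho_frob b : ~~ (7 %| b)%N -> rho (b * p) = rho b.
Proof.
move=> b7; have bp7 := ndvd7M b7 p7.
apply: (root7_inj bp7); rewrite ?rho7 // phi_rho // !phi_frob // phi_rho //.
exact: exprAC.
Qed.

Lemma rho_frobX b j : ~~ (7 %| b)%N -> rho (b * p ^ j) = rho b.
Proof.
move=> b7; elim: j => [|j IH]; first by rewrite muln1.
by rewrite expnSr mulnA rho_frob ?ndvd7M ?ndvd7X.
Qed.

Lemma prime_residue_ker b P : ~~ (7 %| b)%N -> is_ker b P -> prime_residue pi P = rho b.
Proof.
move=> b7 bP; have /is_kerP bPE := bP.
rewrite /prime_residue bPE (negbTE (phi_pi_neq0 b)) (ideal_norm_ker b7 bP).
(* As phi_b separates 7th roots of unity, the defining property has exactly one solution, and the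
   default of [xget] is not taken. *)
apply: xget_subset1 => [|r r' [r7 rE] [r7' rE']] /=.
  by split; [exact: rho7 | rewrite bPE rmorphB rmorphXn /= phi_rho // subrr].
apply: (root7_inj b7) => //; move: rE rE'.
by rewrite !bPE !rmorphB !subr_eq0 => /eqP -> /eqP ->.
Qed.

End Residues.

(** The range j < 6 replaces j < f so as not to depend on f; further j only repeat the coset
    b<p>. *)
Lemma is_ker_eq b c (P : prime_idealr OL) : ~~ (7 %| b)%N -> ~~ (7 %| c)%N ->
  is_ker b P -> is_ker c P = has (fun j => c == b * p ^ j %[mod 7])%N (iota 0 6).
Proof.
move=> b7 c7 /is_kerP bP; apply/is_kerP/hasP => [cP|[j _ /eqP cE] x].
  have [|j jf jE] := @ker_phi_sub b c b7 c7.
    by move=> x bx; apply/eqP; rewrite -cP bP bx.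
  exists j; last exact/eqP.
  have := dvdn_leq (isT : (0 < 6)%N) (ord7_dvd6 p7); rewrite -fE mem_iota; lia.
by rewrite bP (phi_mod c7 cE) phi_frob_eq0.
Qed.

(** The coset b<p> has f elements, a finite check once p is reduced modulo 7. *)
Lemma count_ker b (P : prime_idealr OL) : b \in iota 1 6 -> is_ker b P ->
  count (is_ker^~ P) (iota 1 6) = f.
Proof.
move=> b6 bP.
rewrite (eq_in_count (a2 := fun c =>
    has (fun j => c == b * (p %% 7) ^ j %[mod 7])%N (iota 0 6))); last first.
  move=> c c6; rewrite (is_ker_eq (b7_iota b6) (b7_iota c6) bP).
  by apply: eq_has => j; rewrite -[in RHS]modnMmr modnXm modnMmr.
apply/eqP; move: b b6 {bP}; apply/allP.
rewrite fE; case: (ord7P p7) => [->|->||]; [by vm_compute | by vm_compute | |].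
  by rewrite !inE => /orP[] /eqP ->; vm_compute.
by rewrite !inE => /orP[] /eqP ->; vm_compute.
Qed.

(** * The factorization of (p) *)

Section IdealProducts.
Implicit Types (P : prime_idealr OL) (Ps : seq (prime_idealr OL)).

Lemma in_prod_ideals Ps P0 (xs : nat -> OL) :
  (forall i, (i < size Ps)%N -> xs i \in (nth P0 Ps i : {pred OL})) ->
  \prod_(i < size Ps) xs i \in \big[ideal_mul/pideal 1]_(P <- Ps) (P : {pred OL}).
Proof.
elim: Ps xs => [|P Ps IH] xs xsP.
  by rewrite big_ord0 big_nil; apply/asboolP; exists 1; rewrite mulr1.
rewrite big_cons big_ord_recl /=; apply/asboolP.
exists [:: (xs 0%N, \prod_(i < size Ps) xs i.+1)]; last by rewrite big_seq1.
rewrite /= andbT (xsP 0%N) //=; apply: (IH (fun i => xs i.+1)) => i iPs.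
exact: (xsP i.+1).
Qed.

(** An induction principle: the product ideal is generated by products of one element from each
    factor. *)
Lemma prod_ideals_sub Ps P0 (J : OL -> Prop) :
  J 0 -> (forall x y, J x -> J y -> J (x + y)) -> (forall a x, J x -> J (a * x)) ->
  (forall xs : nat -> OL,
    (forall i, (i < size Ps)%N -> xs i \in (nth P0 Ps i : {pred OL})) ->
    J (\prod_(i < size Ps) xs i)) ->
  forall x, x \in \big[ideal_mul/pideal 1]_(P <- Ps) (P : {pred OL}) -> J x.
Proof.
elim: Ps J => [|P Ps IH] J J0 JD JM Jprod x.
  move=> _; rewrite -[x]mulr1; apply: JM.
  by have := Jprod (fun=> 0); rewrite big_ord0; apply.
rewrite big_cons => /asboolP[s s_in ->].
elim: s s_in => [|[u v] s IHs] /=; first by rewrite big_nil.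
case/andP => /andP[uP vPs] s_in; rewrite big_cons; apply: (JD); last exact: IHs.
(* The first element u is fixed, and the induction hypothesis is used for the y with u y in J. *)
apply: (IH (fun y => J (u * y))) vPs => //=.
- by rewrite mulr0.
- by move=> y z uy uz; rewrite mulrDr; apply: JD.
- by move=> a y uy; rewrite mulrCA; apply: JM.
move=> xs xsP.
have := Jprod (fun i => if i is j.+1 then xs j else u).
by rewrite big_ord_recl /=; apply; case.
Qed.

End IdealProducts.

Section Factorization.
Variable Ps : seq (prime_idealr OL).
Hypothesis PsE : pideal p%:R =i \big[ideal_mul/pideal 1]_(P <- Ps) (P : {pred OL}).
Variable P0 : prime_idealr OL.
Local Notation Q i := (nth P0 Ps i).

Lemma factor_choice_phi (xs : nat -> OL) c :
  (forall i, (i < size Ps)%N -> xs i \in (Q i : {pred OL})) ->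
  \prod_(i < size Ps) phi c (xs i) = 0.
Proof.
move=> /in_prod_ideals; rewrite -PsE => /asboolP[y yE].
by rewrite -rmorph_prod yE rmorphM phi_p mul0r.
Qed.

Lemma factor_above i : (i < size Ps)%N -> p%:R \in (Q i : {pred OL}).
Proof.
move=> iPs; have : p%:R \in pideal (p%:R : OL).
  by apply/asboolP; exists 1; rewrite mulr1.
rewrite PsE; apply: (prod_ideals_sub (P0 := P0) (J := fun x => x \in (Q i : {pred OL}))).
- exact: idealr0.
- by move=> x y; apply: rpredD.
- by move=> a x; apply: idealMr.
by move=> xs xsP; rewrite (bigD1 (Ordinal iPs)) //= mulrC idealMr // xsP.
Qed.

Lemma factor_is_ker i : (i < size Ps)%N -> exists2 b, b \in iota 1 6 & is_ker b (Q i).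
Proof. by move=> /factor_above/prime_above_p. Qed.

(** Otherwise, by [ker_phi_sub], each factor has an element not killed by phi_c; their product lies
    in (p), yet phi_c does not kill it. *)
Lemma ker_is_factor c : ~~ (7 %| c)%N -> exists2 i, (i < size Ps)%N & is_ker c (Q i).
Proof.
move=> c7; apply: contrapT => none.
have ex i : exists x, (i < size Ps)%N -> x \in (Q i : {pred OL}) /\ phi c x != 0.
  apply: contrapT => nx.
  have iPs : (i < size Ps)%N by apply: contrapT => iPs; apply: nx; exists 0.
  apply: none; exists i => //; have [b b6 bQ] := factor_is_ker iPs.
  have b7 := b7_iota b6; have /is_kerP bQE := bQ.
  have [|j _ jE] := @ker_phi_sub b c b7 c7.
    move=> x bx; apply/eqP; apply: contrapT => /negP cx; apply: nx.
    by exists x => _; rewrite bQE bx eqxx.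
  by apply/is_kerP => x; rewrite bQE (phi_mod c7 jE) phi_frob_eq0.
have [xs xsE] := choice ex.
have /eqP := @factor_choice_phi xs c (fun i iPs => (xsE i iPs).1).
apply/negP; apply/prodf_neq0 => i _; exact: (xsE i (ltn_ord i)).2.
Qed.

(* If the kernel K of [phi c] occurred twice, every product of elements of the
   factors would lie in pK, because after moving one factor from K to the other
   the remaining product vanishes under all the homomorphisms [phi b]. *)
Lemma ker_factor_uniq c i j : ~~ (7 %| c)%N -> (i < size Ps)%N -> (j < size Ps)%N ->
  is_ker c (Q i) -> is_ker c (Q j) -> i = j.
Proof.
move=> c7 iPs jPs /is_kerP ci /is_kerP cj; apply/eqP; apply: contraT => ij.
have [z cz] : exists2 z, phi c z = 0 & p%:R = p%:R * z.
  have : p%:R \in pideal (p%:R : OL) by apply/asboolP; exists 1; rewrite mulr1.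
  rewrite PsE.
  apply: (prod_ideals_sub (P0 := P0)
    (J := fun y => exists2 z, phi c z = 0 & y = p%:R * z)).
  - by exists 0; rewrite ?rmorph0 ?mulr0.
  - move=> _ _ [z z0 ->] [z' z'0 ->]; exists (z + z'); last by rewrite mulrDr.
    by rewrite rmorphD z0 z'0 addr0.
  - move=> a _ [z z0 ->]; exists (a * z); last by rewrite mulrCA.
    by rewrite rmorphM z0 mulr0.
  move=> xs xsP; rewrite (bigD1 (Ordinal iPs)) //=.
  set y := (X in _ * X).
  have [|z ->] := @phi_all_eq0 y.
    move=> b b7; have yb : phi b y = phi b (xs j) *
        phi b (\prod_(k < size Ps | (k != Ordinal iPs) && (k != Ordinal jPs)) xs k).
      by rewrite -rmorphM /y (bigD1 (Ordinal jPs)) // -val_eqE /= eq_sym.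
    have := @factor_choice_phi (fun k => if k == i then xs j else xs k) b _.
    rewrite (bigD1 (Ordinal iPs)) //= eqxx => /(_ _)/eqP; rewrite mulf_eq0.
    have -> : \prod_(k < size Ps | k != Ordinal iPs)
        phi b (if k == i :> nat then xs j else xs k) = phi b y.
      by rewrite rmorph_prod; apply: eq_bigr => k /negbTE; rewrite -val_eqE /= => ->.
    move=> H; have : (phi b (xs j) == 0) || (phi b y == 0).
      apply: H => k kPs; case: eqP => [->|_]; last exact: xsP.
      by rewrite ci -cj xsP.
    by case/orP => /eqP // xj0; rewrite yb xj0 mul0r.
  exists (xs i * z); last by rewrite mulrCA.
  by rewrite rmorphM; have := xsP i iPs; rewrite ci => /eqP ->; rewrite mul0r.
(* Cancelling p in L contradicts phi_c(z) = 0. *)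
move=> pz; suff z1 : z = 1 by move/eqP: cz; rewrite z1 rmorph1 oner_eq0.
apply: val_inj; apply: (mulfI (x := val (p%:R : OL))).
  by rewrite rmorph_nat -(fmorph_eq0 L_to_algC) rmorph_nat pnatr_eq0 -lt0n p_gt0.
by rewrite -!rmorphM -pz mulr1.
Qed.

Variable pi : OL.
Hypothesis pi_p : coprime_to pi p.

(** Each factor is the kernel of phi_c for f values of c, all with the same rho_c, and each c
    belongs to exactly one factor: a double count of such pairs. *)
Lemma residue_product :
  (\prod_(P <- Ps) prime_residue pi P) ^+ f = \prod_(c <- iota 1 6) rho pi_p c.
Proof.
rewrite (big_nth P0) big_mkord -prodrXl.
transitivity (\prod_(i < size Ps) \prod_(c <- iota 1 6 | is_ker c (Q i)) rho pi_p c).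
  apply: eq_bigr => i _; have [b b6 bQ] := factor_is_ker (ltn_ord i).
  have b7 := b7_iota b6; rewrite (prime_residue_ker pi_p b7 bQ).
  rewrite -(count_ker b6 bQ) -[LHS]mulr1 -iter_mulr -big_const_seq.
  rewrite big_seq_cond [RHS]big_seq_cond; apply: eq_bigr => c /andP[c6 cQ].
  by rewrite -(prime_residue_ker pi_p b7 bQ) (prime_residue_ker pi_p (b7_iota c6) cQ).
rewrite (exchange_big_dep xpredT) //= big_seq [RHS]big_seq; apply: eq_bigr => c c6.
have [i iPs cQ] := ker_is_factor (b7_iota c6).
rewrite (big_pred1 (Ordinal iPs)) // => j /=.
apply/idP/eqP => [cQj|-> //]; apply: val_inj.
exact: ker_factor_uniq (b7_iota c6) (ltn_ord j) iPs cQj cQ.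
Qed.

Lemma residue_product7 : (\prod_(P <- Ps) prime_residue pi P) ^+ 7 = 1.
Proof.
rewrite (big_nth P0) big_mkord -prodrXl big1 // => i _.
have [b b6 bQ] := factor_is_ker (ltn_ord i).
by rewrite (prime_residue_ker pi_p (b7_iota b6) bQ) rho7 // b7_iota.
Qed.

End Factorization.
(** * The residue of tau modulo p *)

(** Representatives of the cosets of <p> modulo 7, namely the c with sigma_c occurring in [gamma f],
    where 6 stands for -1. *)
Definition coset_reps : seq nat :=
  match f with 1 => [:: 1; 2; 3; 4; 5; 6] | 2 => [:: 1; 4; 5] | 3 => [:: 1; 6]
  | _ => [:: 1] end%N.

Lemma coset_reps7 c : c \in coset_reps -> ~~ (7 %| c)%N.
Proof.
move: c; apply/allP; rewrite /coset_reps.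
by case: f => [|[|[|[|k]]]].
Qed.

Lemma coset_reps_perm b : b \in iota 1 6 ->
  perm_eq
    [seq ((b * c * (p %% 7) ^ j) %% 7)%N | c <- coset_reps, j <- iota 0 f]
    (iota 1 6).
Proof.
move: b; apply/allP; rewrite /coset_reps fE.
case: (ord7P p7) => [->|->||]; [by vm_compute | by vm_compute | |].
  by rewrite !inE => /orP[] /eqP ->; vm_compute.
by rewrite !inE => /orP[] /eqP ->; vm_compute.
Qed.

Lemma ev_frob b x v : ~~ (7 %| b)%N ->
  ev_at (phi b) x v -> ev_at (phi b) (sigma p x) (v ^+ p).
Proof.
move=> b7 [a [s [bs -> aE]]].
apply: (ev_gal (h := phi (b * p)) (c := p)); first exact: sigma_nat.
  by rewrite phi_frob.
exists a, s; rewrite !phi_frob //; split=> //; first by rewrite expf_neq0.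
by rewrite aE exprMn.
Qed.

(** The congruences k_c c = 1 modulo 7 for the coefficients of [gamma 1]: the exponents are 1, 2*4 =
    8, 3*5 = 15, and -6 for c = 6, 3, 2. *)
Lemma gamma1_identity (x1 x2 x3 x4 x5 x6 : F) :
  x1 ^+ 7 = 1 -> x2 ^+ 7 = 1 -> x3 ^+ 7 = 1 ->
  x4 ^+ 7 = 1 -> x5 ^+ 7 = 1 -> x6 ^+ 7 = 1 ->
  x1 / x6 ^+ 6 * (x4 ^+ 4 / x3 ^+ 3) ^+ 2 * (x5 ^+ 5 / x2 ^+ 2) ^+ 3
  = x1 * x2 * x3 * x4 * x5 * x6.
Proof.
move=> r1 r2 r3 r4 r5 r6.
have inv6 (x : F) : x ^+ 7 = 1 -> (x ^+ 6)^-1 = x.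
  move=> x7; apply: (mulIf (x := x ^+ 6)); last by rewrite mulVf -?exprS ?x7 //;
    apply: contra_eq_neq x7 => x60; rewrite exprS x60 mulr0 eq_sym oner_eq0.
  by apply: contra_eq_neq x7 => x60; rewrite exprS x60 mulr0 eq_sym oner_eq0.
have E4 : (x4 ^+ 4) ^+ 2 = x4 by rewrite -exprM -(expr_mod _ r4).
have E5 : (x5 ^+ 5) ^+ 3 = x5 by rewrite -exprM -(expr_mod _ r5).
have E3 : ((x3 ^+ 3) ^+ 2)^-1 = x3 by rewrite -exprM inv6.
have E2 : ((x2 ^+ 2) ^+ 3)^-1 = x2 by rewrite -exprM inv6.
by rewrite !expr_div_n E4 E5 E3 E2 inv6 //; ring.
Qed.

Section TauResidue.
Variables (n : nat) (pi : OL).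
Hypotheses (n_gt0 : (0 < n)%N) (pi_p : coprime_to pi p).
Hypothesis dvd_pow : (7 ^ n %| tau_power p)%N.
Variable R : OL.
Hypotheses (R7 : R ^+ 7 = 1) (RE : R ^+ f = \prod_(c <- iota 1 6) rho pi_p c).

Lemma coset_product b : b \in iota 1 6 ->
  \prod_(c <- coset_reps) rho pi_p (b * c) = R.
Proof.
move=> b6; have b7 := b7_iota b6; set Z := LHS.
have Z7 : Z ^+ 7 = 1.
  rewrite -prodrXl big_seq big1 // => c /coset_reps7 c7.
  by rewrite rho7 // ndvd7M.
have ZE : Z ^+ f = R ^+ f.
  rewrite RE -(perm_big _ (coset_reps_perm b6)) /= big_allpairs_dep /=.
  rewrite -prodrXl big_seq [RHS]big_seq; apply: eq_bigr => c /coset_reps7 c7.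
  have bc7 := ndvd7M b7 c7.
  rewrite (eq_bigr (fun=> rho pi_p (b * c))) => [|j _].
    by rewrite big_const_seq count_predT size_iota iter_mulr_1.
  have e7 : (b * c * p ^ j = b * c * (p %% 7) ^ j %% 7 %[mod 7])%N.
    by rewrite modn_mod -[in RHS]modnMmr modnXm modnMmr.
  by rewrite -(rho_mod pi_p _ e7) ?rho_frobX // ndvd7M // ndvd7X.
(* As f is prime to 7, its inverse modulo 7 recovers a 7th root of unity from its f-th power. *)
have [u uE] : exists u, (f * u = 1 %[mod 7])%N.
  by rewrite fE; case: (ord7P p7) => _; [exists 1%N|exists 4%N|exists 5%N|exists 6%N].
rewrite -[LHS]expr1 -[RHS]expr1 -(expr_mod 1 Z7) -(expr_mod 1 R7) -uE.
by rewrite !expr_mod // !exprM ZE.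
Qed.

Lemma gamma_ev b : b \in iota 1 6 -> exists Y,
  [/\ Y != 0, ev_at (phi b) (gexp (pi : L) (gamma f)) Y & Y ^+ e = phi b R].
Proof.
move=> b6; have b7 := b7_iota b6.
have pi0 : (pi : L) != 0 := pi_neq0 p7 pi_p p_pr (dvdnn p).
pose V c := phi (b * c) pi.
have V0 c : V c != 0 by apply: phi_pi_neq0.
pose r c := phi b (rho pi_p (b * c)).
(* The element rho_(bc) is a root of unity, so phi_(bc) takes it to the c-th power of its image
   under phi_b. *)
have Ve c : ~~ (7 %| c)%N -> V c ^+ e = r c ^+ c.
  by move=> c7; rewrite /V -phi_rho ?ndvd7M // phi_mul_root // rho7 ?ndvd7M.
have r7 c : ~~ (7 %| c)%N -> r c ^+ 7 = 1.
  by move=> c7; rewrite -rmorphXn rho7 ?ndvd7M // rmorph1.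
have Vs c : ~~ (7 %| c)%N -> ev_at (phi b) (sigma c (pi : L)) (V c).
  move=> c7; apply: (ev_gal (h := phi (b * c)) (c := c)); first exact: sigma_nat.
    by rewrite !phiE ?ndvd7M // exprM.
  exact: ev_OL.
have Vc : ev_at (phi b) (sigma (-1) (pi : L)) (V 6%N).
  apply: (ev_gal (h := phi (b * 6)) (c := 6)); first exact: sigma_opp1.
    by rewrite !phiE ?ndvd7M // exprM.
  exact: ev_OL.
have V1 : ev_at (phi b) (pi : L) (V 1%N) by rewrite /V muln1; apply: ev_OL.
have evdiv x y u v : v != 0 -> ev_at (phi b) x u -> ev_at (phi b) y v ->
    ev_at (phi b) (x / y) (u / v).
  by move=> v0 xu yv; apply: evM => //; apply: evV.
rewrite -(coset_product b6) rmorph_prod -/r.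
have [m mE] : exists m, m = e by exists e.
rewrite -mE in Ve *; rewrite /coset_reps fE.
case: (ord7P p7) => _; rewrite ?(gexp_gamma1, gexp_gamma2, gexp_gamma3) //;
  rewrite !big_cons big_nil mulr1 -!/(r _).
- exists (V 1%N / V 6%N * (V 4%N / V 3%N) ^+ 2 * (V 5%N / V 2%N) ^+ 3); split.
  + by rewrite !mulf_neq0 ?expf_neq0 ?mulf_neq0 ?invr_eq0 ?V0.
  + have D1 := evdiv _ _ _ _ (V0 6%N) V1 Vc.
    have D2 := evdiv _ _ _ _ (V0 3%N) (Vs 4%N isT) (Vs 3%N isT).
    have D3 := evdiv _ _ _ _ (V0 2%N) (Vs 5%N isT) (Vs 2%N isT).
    exact: (evM (evM D1 (evX 2 D2)) (evX 3 D3)).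
  rewrite 2!exprMn [((V 4%N / _) ^+ 2) ^+ _]exprAC [((V 5%N / _) ^+ 3) ^+ _]exprAC.
  rewrite [(V 1%N / _) ^+ _]expr_div_n [(V 4%N / _) ^+ _]expr_div_n.
  by rewrite [(V 5%N / _) ^+ _]expr_div_n !Ve // expr1 gamma1_identity ?r7 // !mulrA.
- exists (V 1%N * V 4%N ^+ 2 * V 5%N ^+ 3); split.
  + by rewrite !mulf_neq0 ?expf_neq0 ?V0.
  + exact: (evM (evM V1 (evX 2 (Vs 4%N isT))) (evX 3 (Vs 5%N isT))).
  rewrite 2!exprMn [(V 4%N ^+ 2) ^+ _]exprAC [(V 5%N ^+ 3) ^+ _]exprAC !Ve //.
  rewrite -!exprM -(expr_mod (4 * 2) (r7 4%N isT)).
  by rewrite -(expr_mod (5 * 3) (r7 5%N isT)) -mulrA.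
- exists (V 1%N / V 6%N); split; first by rewrite mulf_neq0 ?invr_eq0.
  + exact: evdiv.
  rewrite expr_div_n !Ve // expr1; congr (_ * _).
  have r6 : r 6%N ^+ 6 * r 6%N = 1 by rewrite -exprSr r7.
  apply: (mulfI (x := r 6%N ^+ 6)).
    by apply: contra_eq_neq r6 => ->; rewrite mul0r eq_sym oner_eq0.
  rewrite r6 mulfV //.
  by apply: contra_eq_neq r6 => ->; rewrite mul0r eq_sym oner_eq0.
exists (V 1%N); rewrite gexp1; split=> //.
by rewrite Ve.
Qed.

Lemma tau_ev b : b \in iota 1 6 ->
  ev_at (phi b) (tau n p pi ^+ (7 ^ (n - 1))) (phi b R).
Proof.
move=> b6; have b7 := b7_iota b6.
have pi0 : (pi : L) != 0 := pi_neq0 p7 pi_p p_pr (dvdnn p).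
have [Y [Y0 YE Ye]] := gamma_ev b6.
rewrite tauE // -exprM.
have -> : (tau_power p %/ 7 ^ n * 7 ^ (n - 1) = tau_power p %/ 7)%N.
  have [k ->] := dvdnP dvd_pow; rewrite mulnK ?expn_gt0 //.
  by rewrite -{2}(subnK n_gt0) expnD mulnA mulnK.
have dvd7 : (7 %| tau_power p)%N by apply: dvdn_trans dvd_pow; rewrite dvdn_exp.
have frob x v : v != 0 -> ev_at (phi b) x v ->
    ev_at (phi b) (sigma p x / x) (v ^+ (p - 1)).
  move=> v0 xv; have -> : v ^+ (p - 1) = v ^+ p / v.
    by rewrite -{2}(subnK p_gt0) addn1 exprSr mulfK.
  by apply: evM; [apply: ev_frob | apply: evV].
(* As sigma_p acts on values as the p-th power, E is (p^f - 1) / Phi_f(p); with the remaining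
   exponent Phi_f(p) / 7 it makes e. *)
suff [E evE EE] : exists2 E, ev_at (phi b) (tau_base p pi) (Y ^+ E)
    & (E * tau_power p = (p ^ f).-1)%N.
  rewrite -Ye -EE -muln_divA // exprM; exact: evX.
move: YE; rewrite /tau_base /tau_power fE; case: (ord7P p7) => _ YE.
- by exists 1%N; rewrite ?expr1 // mul1n subn1.
- exists (p - 1)%N; [exact: frob | have := p_gt0; nia].
- exists (p - 1)%N; [exact: frob | have := p_gt0; nia].
exists ((p - 1) * (p + 1) * (p * p + p + 1))%N; last first.
  have := p_gt0; case: (p) => // k _.
  have -> : (k.+1 ^ 2 - k.+1 = k * k.+1)%N.
    by rewrite -mulnn -[X in (_ - X)%N]mul1n -mulnBl subn1.
  apply/eqP; rewrite -eqSS prednK ?expn_gt0 //; apply/eqP.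
  rewrite subn1 /= -addn1 -[k.+1]addn1; ring.
have evz : let y := gexp (pi : L) (gamma 6) in
    ev_at (phi b) (sigma p (sigma p y / y) * (sigma p y / y))
      (Y ^+ ((p - 1) * (p + 1))).
  by rewrite exprM exprD expr1; apply: evM; [apply: ev_frob => //|]; apply: frob.
cbv zeta; rewrite exprM !exprD expr1 [_ ^+ (p * p)]exprM.
by apply: evM => //; apply: evM; do ?apply: ev_frob.
Qed.

End TauResidue.

End PrimeModulus.

(** * The 7-part of the exponent, and the equivalence *)

Lemma dvd7_natr k : (7 %| k)%N = (k%:R == 0 :> 'F_7).
Proof. by rewrite -(dvdn_pcharf (pchar_Fp (isT : prime 7))). Qed.

Lemma natr_mod7 k : k%:R = (k %% 7)%:R :> 'F_7.
Proof. by apply/val_inj; rewrite /= !val_Fp_nat // modn_mod. Qed.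

(** M^6 - 1 is the product of Phi_d(M) over d dividing 6. The factors with d different from f are
    prime to 7, so 7^n divides Phi_f(M). *)
Lemma pow7_dvd_tau_power (n M : nat) : ~~ (7 %| M)%N ->
  (M ^ 6 = 1 %[mod 7 ^ n])%N -> (7 ^ n %| tau_power M)%N.
Proof.
move=> M7 /eqP; have M0 : (0 < M)%N by case: M M7.
rewrite eqn_mod_dvd ?expn_gt0 ?M0 // => dvdM.
suff [c cE c7] : exists2 c, (M ^ 6 - 1 = tau_power M * c)%N & ~~ (7 %| c)%N.
  by move: dvdM; rewrite cE Gauss_dvdl // coprimeXl // prime_coprime.
have sub1 k l : (k.+1 = l.+1)%N -> k = l by case.
have pred k : (k.+1 - 1 = k)%N by rewrite subn1.
have sqr k : (k.+1 ^ 2 - k.+1 = k * k.+1)%N.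
  by rewrite -mulnn -[X in (_ - X)%N]mul1n -mulnBl subn1.
have M1 : (M - 1)%:R = M%:R - 1 :> 'F_7 by rewrite natrB.
rewrite /tau_power; case: (ord7P M7) => Mr.
- exists (M ^ 5 + M ^ 4 + M ^ 3 + M ^ 2 + M + 1)%N.
    case: (M) M0 => // k _; apply: sub1; rewrite pred subn1 prednK ?expn_gt0 //.
    by rewrite -[RHS]addn1 -[k.+1]addn1; ring.
  by rewrite dvd7_natr !natrD !natrX natr_mod7 Mr.
- exists ((M - 1) * (M ^ 4 + M ^ 2 + 1))%N.
    case: (M) M0 => // k _; apply: sub1; rewrite pred subn1 prednK ?expn_gt0 //.
    by rewrite -[RHS]addn1 -[k.+1]addn1; ring.
  by rewrite dvd7_natr natrM M1 !natrD !natrX natr_mod7 Mr.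
- exists ((M - 1) * (M ^ 3 + 1))%N.
    case: (M) M0 => // k _; apply: sub1; rewrite pred subn1 prednK ?expn_gt0 //.
    by rewrite -[RHS]addn1 -[k.+1]addn1; ring.
  rewrite dvd7_natr natrM M1 !natrD !natrX natr_mod7.
  by move: Mr; rewrite !inE => /orP[] /eqP ->.
exists ((M - 1) * (M + 1) * (M ^ 2 + M + 1))%N.
  case: (M) M0 => // k _; apply: sub1; rewrite pred sqr subn1 prednK ?expn_gt0 //.
  by rewrite -[RHS]addn1 -[k.+1]addn1; ring.
rewrite dvd7_natr !natrM M1 !natrD !natrX natr_mod7.
by move: Mr; rewrite !inE => /orP[] /eqP ->.
Qed.

Lemma prime_imply_tau_congr (n p : nat) (pi : OL) :
  (0 < n)%N -> prime p -> ~~ (7 %| p)%N -> (p ^ 6 = 1 %[mod 7 ^ n])%N ->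
  coprime_to pi p -> power_residue pi (pideal p%:R) <> 1 ->
  exists2 xi : L, 7.-primitive_root xi & eqmodM p (tau n p pi ^+ (7 ^ (n - 1))) xi.
Proof.
move=> n0 p_pr p7 p6 pi_p res1.
have [||F [pF cardF [w w_prim]]] := @residue_field p (ord7 p) p_pr.
- exact: order_gt0.
- by rewrite -eqn_mod_dvd ?expn_gt0 ?prime_gt0 // -ord7_dvdn.
have [phi phiE] := OL_hom_family w_prim.
have [P0 _] := hom_ker_prime (phi 1%N).
have dvd_pow := pow7_dvd_tau_power p7 p6.
pose S : set OL := [set z : OL | exists2 Ps : seq (prime_idealr OL),
    pideal p%:R =i \big[ideal_mul/pideal 1]_(P <- Ps) (P : {pred OL})
    & z = \prod_(P <- Ps) prime_residue pi P]%classic.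
(* Without a factorization of (p) the symbol would have its default value 1, against [res1]. *)
have [Ps PsE resE] : S (power_residue pi (pideal p%:R)).
  apply: xgetPex; apply: contrapT => none; apply: res1.
  by apply: xgetPN => z zS; apply: none; exists z.
set R := power_residue _ _ in res1 resE.
have R7 : R ^+ 7 = 1.
  rewrite resE.
  exact: (residue_product7 p_pr p7 (erefl _) pF cardF w_prim phiE PsE P0 pi_p).
have RE := residue_product p_pr p7 (erefl _) pF cardF w_prim phiE PsE P0 pi_p.
rewrite -resE in RE.
(* The root of unity is the residue symbol itself, primitive because it is not 1. *)
exists (R : L).
  have [k kE] := root7_zO R7.
  have -> : (R : L) = zeta ^+ k by rewrite kE -zO_val -[LHS]/(val _) rmorphXn.
  apply: prim_root7 zeta_prim _; apply/negP => /dvdnP[j jE]; apply: res1.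
  by rewrite kE jE mulnC exprM zO7 expr1n.
exists R; split; last exact: reduces_OL.
have : coprime_frac p (tau n p pi ^+ (7 ^ (n - 1))).
  exact/cfracX/cfrac_gexp/cfrac_OL.
move=> [a [t [aM tM xE]]]; exists a, t; split=> //; first exact: coprime_avoids.
(* With a/t the power of tau, a - R t is divisible by p once every phi_b kills it. *)
apply/asboolP; apply: (phi_all_eq0 p_pr pF w_prim phiE) => b b7.
have b6 : (b %% 7)%N \in iota 1 6 by rewrite mem_iota ltn_mod lt0n b7.
rewrite (phi_mod w_prim phiE b7 (esym (modn_mod _ _))).
have fp : phi (b %% 7)%N p%:R = 0 by rewrite rmorph_nat.
have ft : phi (b %% 7)%N t != 0 := hom_coprime fp tM.
have ev1 := tau_ev n0 dvd_pow R7 RE b6.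
have ev2 : ev_at (phi (b %% 7)%N) (tau n p pi ^+ (7 ^ (n - 1)))
    (phi (b %% 7)%N a / phi (b %% 7)%N t).
  by exists a, t; rewrite divfK.
rewrite rmorphB rmorphM (ev_fun ev1 ev2) divfK //; exact: subrr.
Qed.

Theorem theorem5p1 (n A w M : nat) (pi : OL)
    (n_ge1 : (1 <= n)%N)
    (M_def : M = (A * 7 ^ n + w)%N)
    (A_bound : (0 < A < 7 ^ n)%N)
    (w_bound : (0 < w < 7 ^ n)%N)
    (w_root : (w ^ 6 = 1 %[mod 7 ^ n])%N)
    (pi_coprime : coprime_to pi M)
    (pi_residue : power_residue pi (pideal M%:R) <> 1)
    (M_nodiv : forall x : nat, (1 < x < 7 ^ n)%N -> (x ^ 6 = 1 %[mod 7 ^ n])%N ->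
       ~ (x %| M)%N) :
  [<-> is_true (prime M);
       exists2 xi : L, 7.-primitive_root xi
         & eqmodM M (tau n M pi ^+ (7 ^ (n - 1))) xi;
       [/\ eqmodM M (T_ n M pi (n - 1)) (-1),
           eqmodM M (J_ n M pi (n - 1)) (-2)
         & eqmodM M (N_ n M pi (n - 1)) 1]].
Proof.
have M6 : (M ^ 6 = 1 %[mod 7 ^ n])%N by rewrite -modnXm M_def modnMDl modnXm.
have M7 : ~~ (7 %| M)%N.
  apply/negP => M7; have /eqP : (M ^ 6 = 1 %[mod 7])%N.
    have d7 : (7 %| 7 ^ n)%N by rewrite dvdn_exp.
    by rewrite -(modn_dvdm _ d7) M6 modn_dvdm.
  by rewrite -modnXm (eqP M7).
(* The upper bound forces a composite M to have a prime factor below 7^n. *)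
have /andP[M_gt1 M_lt] : (1 < M < (7 ^ n) ^ 2)%N.
  rewrite M_def; case/andP: A_bound w_bound => A0 AN /andP[w0 wN].
  apply/andP; split; first by rewrite -addn1 leq_add // muln_gt0 A0 expn_gt0.
  by rewrite -mulnn -ltn_divLR ?expn_gt0 // divnMDl ?expn_gt0 // divn_small // addn0.
have q_pr := pdiv_prime M_gt1; have qM := pdiv_dvd M.
tfae.
- by move=> M_pr; apply: prime_imply_tau_congr.
- by move=> [xi xi_prim xiE]; apply: (tau_congr_imply_periods M7 q_pr qM xi_prim xiE).
move=> [TE JE NE]; apply: contraT => Mnp.
have q6 := periods_imply_congr n_ge1 M7 pi_coprime q_pr qM TE JE NE.
have qlt : (pdiv M < 7 ^ n)%N.
  rewrite -ltn_sqr; apply: leq_ltn_trans M_lt; rewrite leqNgt.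
  by apply: contra Mnp; apply: ltn_pdiv2_prime; apply: ltnW.
by case: (M_nodiv _ _ q6 qM); rewrite prime_gt1.
Qed.
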